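(* Let $\mathbb{K}\in\{\mathbb{R},\mathbb{C}\}$, let $A\in\mathbb{K}^{n\times n}$ be self-adjoint with eigenvalues $\lambda_1\ge\dots\ge\lambda_n$ (counted with multiplicity), set $\lambda_0:=\infty$, and let $A=X\Lambda X^*$ be an eigendecomposition with $\Lambda=\mathrm{diag}(\lambda_1,\dots,\lambda_n)$ and $X$ unitary with columns $x_1,\dots,x_n$. Let $\mathcal{X}_\ell=\mathrm{span}\{x_1,\dots,x_\ell\}$ for $1\le\ell\le n$, and $\mathcal{X}_0=\{0\}$. Let $0\le j<h<k\le\mathrm{rank}(A)$, with $k<n$, be such that $\lambda_j>\lambda_{j+1}$ and $\lambda_k>\lambda_{k+1}$. Let $\mathcal{W}\subset\mathbb{K}^n$ be a subspace with $\dim\mathcal{W}=r$, where $h\le r<k$. Let $p_1,p_2\ge 0$ be integers with $p_1+p_2\le r-h$ and $k+p_2\le n$, and assume that $$\mathcal{W}^\perp\cap\mathrm{span}\{x_1,\dots,x_{j+p_1},x_{k+1},\dots,x_{k+p_2}\}=\{0\}\quad\text{and}\quad \mathcal{W}\cap\mathrm{span}\{x_1,\dots,x_k\}^\perp=\{0\}.$$ Then there exists a subspace $\mathcal{H}_p\subset\mathcal{W}$ with $\dim\mathcal{H}_p=r-(p_1+p_2)\ge h$, $\mathcal{H}_p^\perp\cap\mathcal{X}_j=\{0\}$ and $\mathcal{H}_p\cap\mathcal{X}_k^\perp=\{0\}$, such that for every polynomial $\phi\in\mathbb{K}[x]$ with $\phi(\Lambda_k)$ invertible and every unitarily invariant norm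 $\|\cdot\|$, $$d(\Lambda\text{-adm}_h(A),\phi(A)(\mathcal{W}))\le \|\phi(\Lambda_j)^{-1}\|_2\,\|\phi(\Lambda_{j+p_1,\perp})\|_2\,\|\tan\Theta(\mathcal{X}_j,\mathcal{H}_p)\|+\|\phi(\Lambda_k)^{-1}\|_2\,\|\phi(\Lambda_{k+p_2,\perp})\|_2\,\|\tan\Theta(\mathcal{X}_k,\mathcal{H}_p)\|.$$ If $j=0$ (respectively if $k=\mathrm{rank}(A)$ and $\phi(0)=0$), then the first (respectively the second) term on the right-hand side should be omitted.
   Context: For $\ell\le n$, $\Lambda_\ell=\mathrm{diag}(\lambda_1,\dots,\lambda_\ell)$ and $\Lambda_{\ell,\perp}=\mathrm{diag}(\lambda_{\ell+1},\dots,\lambda_n)$ (an empty matrix has norm $0$). $\|\cdot\|_2$ is the operator (spectral) norm. Principal angles: for subspaces $\mathcal{S},\mathcal{T}\subset\mathbb{K}^n$, let $S,T$ be matrices with orthonormal columns spanning $\mathcal{S},\mathcal{T}$, and let $m=\min\{\dim\mathcal{S},\dim\mathcal{T}\}$. The principal angles $0\le\theta_1(\mathcal{S},\mathcal{T})\le\dots\le\theta_m(\mathcal{S},\mathcal{T})\le\pi/2$ are determined by $\cos\theta_i(\mathcal{S},\mathcal{T})=\sigma_i(S^*T)$ (singular values in non-increasing order), and $\Theta(\mathcal{S},\mathcal{T})=\mathrm{diag}(\theta_1,\dots,\theta_m)$; if one subspace is $\{0\}$, $\Theta(\mathcal{S},\mathcal{T})=0$. $\sin\Theta$ and $\tan\Theta$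 are the diagonal matrices of sines and tangents of the principal angles. The conditions on $\mathcal{H}_p$ in the conclusion ensure that the tangents in the bound are well defined. A unitarily invariant norm is a norm on $\mathbb{K}^{n\times n}$ with $\|UMV\|=\|M\|$ for all $M$ and all unitary (orthogonal if $\mathbb{K}=\mathbb{R}$) $U,V$; it is evaluated at smaller matrices by padding them with zeros to size $n\times n$. $\Lambda$-admissible subspaces (with respect to the fixed indices $j,k$): $\Lambda\text{-adm}_h(A)=\{\mathcal{S}\subset\mathbb{K}^n \text{ subspace}: \dim\mathcal{S}=h,\ \mathcal{X}_j\subseteq\mathcal{S}\subseteq\mathcal{X}_k\}$. The distance is $d(\Lambda\text{-adm}_h(A),\mathcal{T})=\inf\{\|\sin\Theta(\mathcal{S},\mathcal{T})\|:\mathcal{S}\in\Lambda\text{-adm}_h(A)\}$. *)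

(* Defs.v *)
From HB Require Import structures.
From mathcomp Require Import all_boot all_order all_algebra.
From mathcomp Require Import sesquilinear.
From mathcomp Require Import complex.
From mathcomp Require Import all_classical all_reals all_analysis.

Set Implicit Arguments.
Unset Strict Implicit.
Unset Printing Implicit Defensive.

Import Order.TTheory GRing.Theory Num.Theory.
Local Open Scope ring_scope.

(* The two cases K = R and K = C are treated uniformly: K is [scalars R c],
   where R is the real field and c selects R itself or R[i]. *)
Variant scalar_kind := RealScalars | ComplexScalars.

Definition scalars (R : realType) (c : scalar_kind) : numFieldType :=
  match c with
  | RealScalars => R
  | ComplexScalars => R[i]
  end.

Section Scalars.
Variables (R : realType) (c : scalar_kind).
Local Notation K := (scalars R c).

Definition of_real : R -> K :=
  match c return R -> scalars R c with
  | RealScalars => id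
  | ComplexScalars => real_complex R
  end.

Definition modulus : K -> R :=
  match c return scalars R c -> R with
  | RealScalars => fun x => `|x|
  | ComplexScalars => @Normc.normc R
  end.

Definition conj_morphism : InvolutiveRMorphism.type K :=
  match c return InvolutiveRMorphism.type (scalars R c) with
  | RealScalars => idfun
  | ComplexScalars => Num.conj
  end.

Definition conjs : K -> K := conj_morphism.
HB.instance Definition _ := InvolutiveRMorphism.on conjs.

End Scalars.
Arguments conjs {R c} _.
Arguments of_real {R} c _.
Arguments modulus {R c} _.

Local Open Scope classical_set_scope.

Section MatrixNotions.
Variables (R : realType) (c : scalar_kind).
Local Notation K := (scalars R c).

Definition adjmx m n (M : 'M[K]_(m, n)) : 'M[K]_(n, m) := map_mx conjs M^T.

Definition unitary n (U : 'M[K]_n) : Prop := adjmx U *m U = 1%:M.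

(* The n x n diagonal matrix of the real numbers s_0, s_1, ...; since s`_i = 0
   for size s <= i, this is also diag(s) padded with zeros to size n x n. *)
Definition diag_seq n (s : seq R) : 'M[K]_n :=
  diag_mx (\row_(i < n) of_real c s`_i).

(* phi(M) for a square matrix of any size, 0 x 0 included; [horner_mx] exists
   in positive size only, where the two agree by [mxevalE]. *)
Definition mxeval n (phi : {poly K}) (M : 'M[K]_n) : 'M[K]_n :=
  \sum_(i < size phi) phi`_i *: M ^+ i.

Lemma mxevalE n (phi : {poly K}) (M : 'M[K]_n.+1) :
  mxeval phi M = horner_mx M phi.
Proof.
rewrite -[phi in RHS]coefK poly_def rmorph_sum; apply: eq_bigr => i _.
by rewrite /= linearZ /= rmorphXn /= horner_mx_X.
Qed.

Definition vnorm n (v : 'cV[K]_n) : R :=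
  Num.sqrt (\sum_(i < n) modulus (v i ord0) ^+ 2).

Definition opnorm m n (M : 'M[K]_(m, n)) : R :=
  sup [set vnorm (M *m v) | v in [set v : 'cV[K]_n | vnorm v <= 1]].

Record unitarily_invariant_norm n (N : 'M[K]_n -> R) : Prop := {
  uinorm_definite : forall M, N M = 0 -> M = 0;
  uinorm_scale : forall (a : K) M, N (a *: M) = modulus a * N M;
  uinorm_triangle : forall M M', N (M + M') <= N M + N M';
  uinorm_unitary : forall U V M, unitary U -> unitary V ->
    N (U *m M *m V) = N M
}.

(* s lists the min(m, n) singular values of M, read off an SVD M = U S V^*. *)
Definition is_singular_values m n (M : 'M[K]_(m, n)) (s : seq R) : Prop :=
  [/\ size s = minn m n, sorted >=%R s, all (>= 0) s &
      exists (U : 'M[K]_m) (V : 'M[K]_n),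
        [/\ unitary U, unitary V &
            M = U *m (\matrix_(i, j) if i == j :> nat then of_real c s`_i else 0)
                  *m adjmx V]].

Definition singular_values m n (M : 'M[K]_(m, n)) : seq R :=
  xget [::] (is_singular_values M).

End MatrixNotions.

Section Subspaces.
Variables (R : realType) (c : scalar_kind) (n : nat).
Local Notation K := (scalars R c).
Implicit Types (S T W : {vspace 'cV[K]_n}).

Fact one_hermitian_subproof :
  (1%:M : 'M[K]_1) \is hermitianmx 1 false (@conjs R c).
Proof. by apply/is_hermitianmxP; rewrite expr0 scale1r tr_scalar_mx map_mx1. Qed.

Definition one_hermitian : hermitian_matrix 1 false (@conjs R c) :=
  HermitianMx one_hermitian_subproof.

(* <u, v> = v^* u *)
Definition inner (u v : 'cV[K]_n) : K :=
  form_of_matrix (@conjs R c) one_hermitian u v.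
HB.instance Definition _ :=
  Bilinear.copy inner (form_of_matrix (@conjs R c) one_hermitian).
HB.instance Definition _ :=
  Hermitian.copy inner (form_of_matrix (@conjs R c) one_hermitian).

Lemma innerE (u v : 'cV[K]_n) :
  inner u v = \sum_(i < n) u i ord0 * conjs (v i ord0).
Proof.
rewrite /inner /form_of_matrix mulmx1 mxtrace_mulC trace_mx11 mxE.
by apply: eq_bigr => i _; rewrite !mxE mulrC.
Qed.

Definition orthc W : {vspace 'cV[K]_n} := orthov inner W.

Definition colspan p (M : 'M[K]_(n, p)) (P : pred nat) : {vspace 'cV[K]_n} :=
  <<[seq col i M | i : 'I_p <- enum 'I_p & P i]>>%VS.

Definition is_onbasis W (B : 'M[K]_(n, \dim W)) : Prop :=
  adjmx B *m B = 1%:M /\ colspan B predT = W.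

Definition onbasis W : 'M[K]_(n, \dim W) := xget 0 (@is_onbasis W).

(* The min(dim S, dim T) principal angles, in non-decreasing order. *)
Definition principal_angles S T : seq R :=
  [seq acos s | s <- singular_values (adjmx (onbasis S) *m onbasis T)].

(* Both diagonal matrices are padded with zeros to size n x n, the form in which
   a norm on n x n matrices is applied to them. *)
Definition sinTheta S T : 'M[K]_n :=
  diag_seq c n [seq sin t | t <- principal_angles S T].
Definition tanTheta S T : 'M[K]_n :=
  diag_seq c n [seq tan t | t <- principal_angles S T].

Definition mximage (M : 'M[K]_n) W : {vspace 'cV[K]_n} :=
  (linfun (mulmx M : 'cV[K]_n -> 'cV[K]_n) @: W)%VS.

(* X_l, the span of the first l columns of X *)
Definition leading (X : 'M[K]_n) (l : nat) : {vspace 'cV[K]_n} :=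
  colspan X (fun i => i < l)%N.

Definition Lambda_adm (X : 'M[K]_n) (j k h : nat) : set {vspace 'cV[K]_n} :=
  [set S | [/\ \dim S = h, (leading X j <= S)%VS & (S <= leading X k)%VS]].

Definition dist_adm (N : 'M[K]_n -> R) (X : 'M[K]_n) (j k h : nat) T : R :=
  inf [set N (sinTheta S T) | S in Lambda_adm X j k h].

End Subspaces.

(* Main.v *)
Require Import Defs.
From HB Require Import structures.
From mathcomp Require Import all_boot all_order all_algebra.
From mathcomp Require Import sesquilinear spectral complex.
From mathcomp Require Import all_fingroup.
From mathcomp Require Import all_classical all_reals all_analysis.
From mathcomp Require Import lra ring zify.
Import Order.TTheory GRing.Theory Num.Theory.
Local Open Scope ring_scope.

Set Implicit Arguments.
Unset Strict Implicit.
Unset Printing Implicit Defensive.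

(* Write P_U for the orthogonal projection to U and F = phi(A), T = F(W). Take
   for H_p the part of W orthogonal to x_i for j < i <= j + p_1 and
   k < i <= k + p_2. The projection of F(H_p) to X_k meets the orthogonal
   complement of X_j in dimension at least h - j; choose S' of dimension h - j
   in this intersection and S = X_j + S', an admissible subspace with
   P_S = P_{X_j} + P_{S'}. Then ||sin Theta(S, T)|| = ||(1 - P_T) P_S|| is at most
   ||(1 - P_T) P_{X_j}|| + ||(1 - P_T) P_{S'}||. For l = j, k, the subspace H_p
   contains the graph of a linear map, of norm ||tan Theta(X_l, H_p)||, from its
   projection to X_l into X_l^perp; conjugating that map by F gives a graph
   inside T, and projecting along it gives the two terms. *)

(** Orthogonality of H_p to the listed x_i is what moves the tails from l + 1 to l + p + 1, with p =
    p_1 for l = j and p = p_2 for l = k: the graph map over X_l then has no component along x_{l+1},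
    ..., x_{l+p}, so F acts on its values with norm at most ||phi(Lambda_{l+p,perp})||, while
    inverting F on X_l costs ||phi(Lambda_l)^{-1}||. Such a graph controls only the vectors of
    F(P_{X_l}(H_p)). For l = j this is all of X_j, since H_p^perp meets X_j trivially. For l = k it
    has dimension r - (p_1 + p_2) < k and is a proper subspace of X_k, which is why S' has to be
    chosen inside it; the dimension is at least h because F is injective on X_k and H_p meets
    X_k^perp trivially. Norms are compared through Gram matrices: M and M' with the same M^H M
    differ by a unitary factor on the left, so the sine and tangent matrices are recognised from M^H
    M alone. Factors are removed by writing a contraction as an average of unitaries. *)

Local Notation "A ^H" := (adjmx A) (at level 1, format "A ^H") : ring_scope.

(** * Scalars, adjoints and Gram matrices, uniformly over both fields *)

Section ScalarTheory.
Variables (R : realType) (c : scalar_kind).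
Local Notation K := (scalars R c).

Lemma of_real_is_zmod_morphism : zmod_morphism (@of_real R c).
Proof. by case: c => //= x y; rewrite /= rmorphB. Qed.

Lemma of_real_is_monoid_morphism : monoid_morphism (@of_real R c).
Proof. by case: c; split=> //= x y; rewrite /= rmorphM. Qed.

HB.instance Definition _ :=
  GRing.isZmodMorphism.Build R K (of_real c) of_real_is_zmod_morphism.
HB.instance Definition _ :=
  GRing.isMonoidMorphism.Build R K (of_real c) of_real_is_monoid_morphism.

Lemma of_real_inj : injective (@of_real R c).
Proof. exact: fmorph_inj. Qed.

Lemma conjsK : involutive (@conjs R c).
Proof. exact: rmorphK. Qed.

Lemma conjs_of_real (x : R) : conjs (of_real c x) = of_real c x.
Proof. by rewrite /conjs; case: c => //=; exact: conjc_real. Qed.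

Lemma mul_conjs (x : K) : x * conjs x = of_real c (modulus x ^+ 2).
Proof.
rewrite /conjs; move: x; case: c => /= x; first by rewrite real_normK ?num_real.
by rewrite rmorphXn /= -sqr_normc.
Qed.

Lemma modulus_ge0 (x : K) : 0 <= modulus x.
Proof. by move: x; case: c => //= -[a b]; exact: sqrtr_ge0. Qed.

Lemma modulusM (x y : K) : modulus (x * y) = modulus x * modulus y.
Proof. by move: x y; case: c => /= x y; [exact: normrM | exact: Normc.normcM]. Qed.

Lemma modulus_of_real (x : R) : modulus (of_real c x) = `|x|.
Proof. by case: c => //=; rewrite expr0n addr0 sqrtr_sqr. Qed.

Lemma modulus_eq0 (x : K) : (modulus x == 0) = (x == 0).
Proof.
have := mul_conjs x; have [->|x0] := eqVneq x 0 => [|e].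
  by rewrite mul0r => /esym/eqP; rewrite fmorph_eq0 expf_eq0.
have: of_real c (modulus x ^+ 2) != 0 by rewrite -e mulf_neq0 ?fmorph_eq0.
by rewrite fmorph_eq0 expf_eq0 /= => /negPf.
Qed.

Lemma modulus0 : modulus (0 : K) = 0.
Proof. by apply/eqP; rewrite modulus_eq0. Qed.

Lemma modulusV (x : K) : modulus x^-1 = (modulus x)^-1.
Proof.
have [->|x0] := eqVneq x 0; first by rewrite invr0 modulus0 invr0.
have m0 : modulus x != 0 by rewrite modulus_eq0.
apply: (mulfI m0); rewrite -modulusM !divff //.
by rewrite -(rmorph1 (of_real c)) modulus_of_real normr1.
Qed.

Lemma conjs_fixed (x : K) : conjs x = x -> exists a, x = of_real c a.
Proof.
rewrite /conjs; move: x; case: c => /= x; first by exists x.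
by move=> xr; exists (complex.Re x); apply/esym/RRe_real/CrealP.
Qed.

Lemma adjmxE m n (A : 'M[K]_(m, n)) i j : A^H i j = conjs (A j i).
Proof. by rewrite !mxE. Qed.

Lemma adjmxK m n (A : 'M[K]_(m, n)) : A^H^H = A.
Proof. by apply/matrixP => i j; rewrite !adjmxE conjsK. Qed.

Lemma adjmxM m n p (A : 'M[K]_(m, n)) (B : 'M[K]_(n, p)) : (A *m B)^H = B^H *m A^H.
Proof. by rewrite /adjmx trmx_mul map_mxM. Qed.

Lemma adjmxD m n (A B : 'M[K]_(m, n)) : (A + B)^H = A^H + B^H.
Proof. by rewrite /adjmx linearD /= map_mxD. Qed.

Lemma adjmxN m n (A : 'M[K]_(m, n)) : (- A)^H = - A^H.
Proof. by rewrite /adjmx linearN /= map_mxN. Qed.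

Lemma adjmxB m n (A B : 'M[K]_(m, n)) : (A - B)^H = A^H - B^H.
Proof. by rewrite adjmxD adjmxN. Qed.

Lemma adjmxZ m n a (A : 'M[K]_(m, n)) : (a *: A)^H = conjs a *: A^H.
Proof. by rewrite /adjmx linearZ /= map_mxZ. Qed.

Lemma adjmx1 n : (1%:M : 'M[K]_n)^H = 1%:M.
Proof. by rewrite /adjmx trmx1 map_mx1. Qed.

Lemma adjmx0 m n : (0 : 'M[K]_(m, n))^H = 0.
Proof. by rewrite /adjmx trmx0 map_mx0. Qed.

Lemma unitary_mulV n (U : 'M[K]_n) : unitary U -> U *m U^H = 1%:M.
Proof. exact: mulmx1C. Qed.

Lemma unitary_adj n (U : 'M[K]_n) : unitary U -> unitary U^H.
Proof. by move=> /unitary_mulV; rewrite /unitary adjmxK. Qed.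

Lemma unitary1 n : unitary (1%:M : 'M[K]_n).
Proof. by rewrite /unitary adjmx1 mulmx1. Qed.

Lemma unitaryM n (U V : 'M[K]_n) : unitary U -> unitary V -> unitary (U *m V).
Proof.
by move=> Uu Vu; rewrite /unitary adjmxM mulmxA -(mulmxA V^H) Uu mulmx1.
Qed.

Lemma gram_diagE m n (A : 'M[K]_(m, n)) j :
  (A^H *m A) j j = of_real c (\sum_i modulus (A i j) ^+ 2).
Proof.
rewrite mxE rmorph_sum; apply: eq_bigr => i _.
by rewrite adjmxE mulrC mul_conjs.
Qed.

Lemma gram_diag_eq0 m n (A : 'M[K]_(m, n)) j :
  (A^H *m A) j j = 0 -> forall i, A i j = 0.
Proof.
rewrite gram_diagE => /eqP; rewrite fmorph_eq0 psumr_eq0; last by move=> i _; exact: sqr_ge0.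
move=> /allP h i.
by apply/eqP; rewrite -modulus_eq0 -[_ == 0](expf_eq0 _ 2%N); apply: h; rewrite mem_index_enum.
Qed.

Lemma gram_eq0 m n (A : 'M[K]_(m, n)) : A^H *m A = 0 -> A = 0.
Proof.
move=> A0; apply/matrixP => i j; rewrite mxE.
by apply: gram_diag_eq0; rewrite A0 mxE.
Qed.

Lemma gram_diag_real m n (A : 'M[K]_(m, n)) j :
  exists2 a : R, 0 <= a & (A^H *m A) j j = of_real c a.
Proof. by rewrite gram_diagE; eexists; last by []; apply: sumr_ge0 => i _; apply: sqr_ge0. Qed.

Lemma unit_multiple n (v : 'cV[K]_n) :
  v != 0 -> exists2 a : R, a != 0 & (of_real c a *: v)^H *m (of_real c a *: v) = 1%:M.
Proof.
move=> v0; have [b b0 vb] := gram_diag_real v ord0.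
have b_neq0 : b != 0.
  apply: contra v0 => /eqP b0'; apply/eqP/gram_eq0/matrixP => i j.
  by rewrite !ord1 vb b0' rmorph0 mxE.
exists (Num.sqrt b)^-1; first by rewrite invr_eq0 sqrtr_eq0 -ltNge lt_def b_neq0.
rewrite adjmxZ -scalemxAl -scalemxAr scalerA conjs_of_real -rmorphM /=.
rewrite -invfM -expr2 sqr_sqrtr //.
by apply/matrixP => i j; rewrite !ord1 mxE vb -rmorphM mulVf // rmorph1 mxE.
Qed.

End ScalarTheory.

(** * Rectangular diagonal matrices, and factorisation from a diagonal Gram matrix *)

Section RectangularDiagonal.
Variables (R : realType) (c : scalar_kind).
Local Notation K := (scalars R c).

(** The diagonal is a function on [nat], so that one [f] serves every shape and a list read by
    [nth 0] is padded with zeros automatically. *)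
Definition rdiag m n (f : nat -> R) : 'M[K]_(m, n) :=
  \matrix_(i, j) if i == j :> nat then of_real c (f i) else 0.

Lemma eq_rdiag m n (f g : nat -> R) :
  (forall i, (i < m)%N -> (i < n)%N -> f i = g i) -> rdiag m n f = rdiag m n g.
Proof.
by move=> fg; apply/matrixP => i j; rewrite !mxE; case: eqP => // e; rewrite fg // e.
Qed.

Lemma rdiag_adj m n f : (rdiag m n f)^H = rdiag n m f.
Proof.
apply/matrixP => i j; rewrite adjmxE !mxE eq_sym.
by case: eqP => [->|_]; rewrite ?conjs_of_real ?rmorph0.
Qed.

Lemma rdiag1 n : rdiag n n (fun=> 1) = 1%:M.
Proof. by apply/matrixP => i j; rewrite !mxE rmorph1 -val_eqE; case: eqP. Qed.

Lemma rdiagB m n f g : rdiag m n f - rdiag m n g = rdiag m n (fun i => f i - g i).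
Proof. by apply/matrixP => i j; rewrite !mxE; case: eqP; rewrite ?rmorphB ?subr0. Qed.

Lemma mul_mx_rdiagE m n p (A : 'M[K]_(m, n)) f i (j : 'I_p) :
  (A *m rdiag n p f) i j = if insub (j : nat) is Some k then A i k * of_real c (f j) else 0.
Proof.
rewrite mxE; case: insubP => [k kn kj|jn]; last first.
  rewrite big1 // => k _; rewrite !mxE; case: eqP => [kj|]; last by rewrite mulr0.
  by rewrite -kj ltn_ord in jn.
rewrite (bigD1 k) //= big1 => [|l lk]; first by rewrite mxE kj eqxx addr0.
by rewrite mxE -kj [_ == _ :> nat](negPf lk) mulr0.
Qed.

(** Diagonal entries beyond the middle dimension [n] are lost in the product, so [f i * g i] has to
    vanish there. *)
Lemma rdiagM m n p f g :
    (forall i, (n <= i)%N -> (i < m)%N -> (i < p)%N -> f i * g i = 0) ->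
  rdiag m n f *m rdiag n p g = rdiag m p (fun i => f i * g i).
Proof.
move=> fg; apply/matrixP => i j; rewrite mul_mx_rdiagE mxE.
case: insubP => [k kn kj|jn].
  by rewrite mxE kj; case: eqP => [->|]; rewrite ?rmorphM ?mul0r.
by case: eqP => [ij|//]; rewrite fg ?rmorph0 // ij // leqNgt.
Qed.

Lemma rdiagMs n p f g : rdiag n n f *m rdiag n p g = rdiag n p (fun i => f i * g i).
Proof.
apply/matrixP => i j; rewrite mul_mx_rdiagE mxE.
case: insubP => [k kn kj|jn].
  by rewrite mxE kj; case: eqP => [->|]; rewrite ?rmorphM ?mul0r.
by case: eqP => // ij; rewrite -ij ltn_ord in jn.
Qed.

Lemma diag_seqE n (s : seq R) : diag_seq c n s = rdiag n n (nth 0 s).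
Proof.
by apply/matrixP => i j; rewrite !mxE -val_eqE; case: eqP; rewrite ?mulr1n ?mulr0n.
Qed.

(** The columns of [M] are orthonormal or zero. Each zero column is replaced by a unit vector
    orthogonal to all columns, by induction on the number of zero columns; multiplying by the
    indicator of [b] erases the new columns again. *)
Lemma gram_complete n (b : pred nat) (M : 'M[K]_n) :
    M^H *m M = rdiag n n (fun i => (b i)%:R) ->
  exists2 U : 'M[K]_n, unitary U & M = U *m rdiag n n (fun i => (b i)%:R).
Proof.
have [d] := ubnP #|[set i : 'I_n | ~~ b i]|; elim: d => // d IH in b M *.
rewrite ltnS => led MM; have [e|[i0]] := set_0Vmem [set i : 'I_n | ~~ b i].
  have br: rdiag n n (fun i => (b i)%:R) = 1%:M.
    rewrite -rdiag1; apply: eq_rdiag => i ltin _.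
    by move/setP/(_ (Ordinal ltin)): e; rewrite !inE /= => /negbFE ->.
  by exists M; rewrite ?br ?mulmx1 // /unitary MM br.
rewrite inE => bi0.
have Mi0 i : M i i0 = 0.
  by apply: gram_diag_eq0; rewrite MM mxE eqxx (negPf bi0) rmorph0.
(* A zero column makes [M] singular; the adjoint of a left null vector is orthogonal to every
   column. *)
have /det0P[v v0 vM]: \det M == 0.
  rewrite -det_tr; apply/det0P; exists (delta_mx 0 i0).
    by apply/eqP => /matrixP/(_ 0 i0)/eqP; rewrite !mxE !eqxx oner_eq0.
  by apply/matrixP => i j; rewrite -rowE !mxE Mi0.
have [|a a0 uu] := @unit_multiple R c n v^H.
  by apply: contra v0 => /eqP v0; rewrite -[v]adjmxK v0 adjmx0.
set u := _ *: _ in uu.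
have Mu : M^H *m u = 0 by rewrite /u -scalemxAr -adjmxM vM adjmx0 scaler0.
have uM : u^H *m M = 0 by rewrite -[M]adjmxK -adjmxM Mu adjmx0.
pose b' (i : nat) := (i == i0) || b i.
pose e : 'M[K]_(1, n) := delta_mx 0 i0.
have [||U Uu MU] := IH b' (M + u *m e).
- apply: leq_trans led; apply: proper_card; apply/properP; split.
    by apply/fintype.subsetP => i; rewrite !inE /b' negb_or => /andP[].
  by exists i0; rewrite !inE /b' ?eqxx.
- rewrite adjmxD adjmxM mulmxDl !mulmxDr mulmxA Mu mul0mx addr0 MM.
  rewrite -!mulmxA uM mulmx0 add0r [u^H *m _]mulmxA uu mul1mx.
  apply/matrixP => i j; rewrite !mxE big_ord1 !adjmxE !mxE /b' !eqxx !andTb -!val_eqE /=.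
  rewrite -(rmorph_nat (of_real c)) conjs_of_real -(rmorph_nat (of_real c)) -rmorphM.
  case: (eqVneq (i : nat) j) => [<-|ij].
    case: (eqVneq (i : nat) i0) => [->|]; last by rewrite mulr0 rmorph0 addr0.
    by rewrite (negPf bi0) mulr1 rmorph0 add0r.
  rewrite add0r; case: (eqVneq (i : nat) i0) => [<-|]; last by rewrite mul0r rmorph0.
  by rewrite eq_sym (negPf ij) mulr0 rmorph0.
exists U => //.
have Eb: rdiag n n (fun i => (b i)%:R) =
    rdiag n n (fun i => (b' i)%:R) *m rdiag n n (fun i => (b i)%:R).
  rewrite rdiagMs; apply: eq_rdiag => i _ _; rewrite /b'.
  by case: (b i); rewrite ?orbT ?mulr1 ?mulr0.
rewrite Eb mulmxA -MU mulmxDl.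
have -> : u *m e *m rdiag n n (fun i => (b i)%:R) = 0.
  rewrite -mulmxA [e *m _](_ : _ = 0) ?mulmx0 //.
  apply/matrixP => i j; rewrite -rowE !mxE; case: eqP => // _.
  by rewrite (negPf bi0) rmorph0.
rewrite addr0; apply/matrixP => i j; rewrite mul_mx_rdiagE valK.
case bj: (b j); first by rewrite rmorph1 mulr1.
by rewrite rmorph0 mulr0; apply: gram_diag_eq0; rewrite MM mxE eqxx bj rmorph0.
Qed.

(** Column [i] is divided by [f i]. As the inverse of 0 is 0, the columns with [f i = 0] stay zero
    and the Gram matrix becomes the indicator of [f i != 0]. *)
Lemma gram_factor_square n (f : nat -> R) (M : 'M[K]_n) :
    M^H *m M = rdiag n n (fun i => f i ^+ 2) ->
  exists2 U : 'M[K]_n, unitary U & M = U *m rdiag n n f.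
Proof.
move=> MM; pose M' := M *m rdiag n n (fun i => (f i)^-1).
have [|U Uu MU] := @gram_complete n (fun i => f i != 0) M'.
  rewrite adjmxM rdiag_adj mulmxA -(mulmxA _ _ M) MM !rdiagMs.
  apply: eq_rdiag => i _ _; have [->|fi] := eqVneq (f i) 0; first by rewrite invr0 !mul0r.
  by rewrite expr2 mulrA mulVf // mul1r divff.
exists U => //; have -> : rdiag n n f = rdiag n n (fun i => (f i != 0)%:R) *m rdiag n n f.
  rewrite rdiagMs; apply: eq_rdiag => i _ _.
  by case: eqVneq => [->|]; rewrite ?mul1r ?mul0r.
rewrite mulmxA -MU -mulmxA rdiagMs; apply/matrixP => i j; rewrite mul_mx_rdiagE valK.
have [fj|fj] := eqVneq (f j) 0; last by rewrite mulVf // rmorph1 mulr1.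
rewrite fj mulr0 rmorph0 mulr0; apply: gram_diag_eq0.
by rewrite MM mxE eqxx fj expr0n rmorph0.
Qed.

(** Multiplying by [J] appends [m - n] zero columns, which reduces to the square case. *)
Lemma gram_factor m n (f : nat -> R) (M : 'M[K]_(m, n)) : (n <= m)%N ->
    M^H *m M = rdiag n n (fun i => f i ^+ 2) ->
  exists2 U : 'M[K]_m, unitary U & M = U *m rdiag m n f.
Proof.
move=> lenm MM; pose J := rdiag n m (fun=> 1).
pose f' i := if (i < n)%N then f i else 0.
have [|U Uu MU] := @gram_factor_square m f' (M *m J).
  rewrite adjmxM rdiag_adj mulmxA -(mulmxA _ _ M) MM -mulmxA rdiagMs.
  apply/matrixP => i j; rewrite mul_mx_rdiagE mxE /f'.
  case: insubP => [k kn kj|jn].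
    by rewrite mxE kj; case: eqP => [->|]; rewrite ?mul0r // kn rmorph1 mul1r mulr1.
  by case: eqP => // ->; rewrite (negPf jn) expr0n rmorph0.
exists U => //; have JJ : J *m rdiag m n (fun=> 1) = 1%:M.
  rewrite rdiagM => [|i lemi ltin]; last by rewrite ltnNge (leq_trans lenm lemi) in ltin.
  by rewrite -rdiag1; apply: eq_rdiag => i _ _; rewrite mulr1.
rewrite -[M]mulmx1 -JJ mulmxA MU -mulmxA rdiagMs; congr (_ *m _).
by apply: eq_rdiag => i _ ltin; rewrite /f' ltin mulr1.
Qed.

Lemma orthonormal_leq m n (E : 'M[K]_(n, m)) : E^H *m E = 1%:M -> (m <= n)%N.
Proof.
move=> EE; rewrite -[m](mxrank1 K) -EE.
exact: leq_trans (mulmx_max_rank _ _) (leqnn n).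
Qed.

Lemma orthonormal_complete m n (E : 'M[K]_(n, m)) : E^H *m E = 1%:M ->
  exists2 U : 'M[K]_n, unitary U & E = U *m rdiag n m (fun=> 1).
Proof.
move=> EE; apply: gram_factor; first exact: orthonormal_leq EE.
by rewrite EE -rdiag1; apply: eq_rdiag => i _ _; rewrite expr1n.
Qed.

End RectangularDiagonal.

(** * Spectral theorem and singular value decomposition *)

Section SpectralTheorem.
Variables (R : realType).

Lemma hermitian_left_eigenvalue_real c n (A : 'M[scalars R c]_n) a (v : 'rV_n) :
  A^H = A -> v *m A = a *: v -> v != 0 -> conjs a = a.
Proof.
move=> Ah vA v0; have Av : A *m v^H = conjs a *: v^H.
  by rewrite -[LHS]adjmxK adjmxM adjmxK Ah vA adjmxZ.
have: a *: (v *m v^H) = conjs a *: (v *m v^H).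
  by rewrite scalemxAl -vA -mulmxA Av scalemxAr.
move/eqP; rewrite -subr_eq0 -scalerBl scaler_eq0 subr_eq0 => /orP[/eqP //|/eqP vv].
have := @gram_eq0 R c n 1 v^H; rewrite adjmxK => /(_ vv) v0'.
by case/eqP: v0; rewrite -[v]adjmxK v0' adjmx0.
Qed.

(** Over the complex numbers an eigenvalue exists by algebraic closure and is real. A real symmetric
    matrix is read as a complex Hermitian one; its real eigenvalue is a root of the same
    characteristic polynomial. *)
Lemma hermitian_char_root c n (A : 'M[scalars R c]_n.+1) : A^H = A ->
  exists a, root (char_poly A) (of_real c a).
Proof.
have complex_case (B : 'M[scalars R ComplexScalars]_n.+1) : B^H = B ->
    exists a, root (char_poly B) (of_real ComplexScalars a).
  move=> Bh; have [|a aB] := @eigenvalue_closed R[i] n.+1 B; first by [].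
  have [v vB v0] := eigenvalueP aB.
  have [b ab] := conjs_fixed (hermitian_left_eigenvalue_real Bh vB v0).
  by exists b; rewrite -ab -eigenvalue_root_char.
case: c A => [A Ah|]; last exact: complex_case.
pose B : 'M[scalars R ComplexScalars]_n.+1 := map_mx (real_complex R) A.
have [|a] := complex_case B.
  apply/matrixP => i j; have Aij : A i j = A j i by rewrite -[in LHS]Ah adjmxE.
  by rewrite adjmxE !mxE Aij; exact: conjc_real.
by rewrite -map_char_poly fmorph_root; exists a.
Qed.

Variable c : scalar_kind.
Local Notation K := (scalars R c).

Lemma hermitian_eigenvector n (A : 'M[K]_n.+1) : A^H = A ->
  exists a, exists2 v : 'cV[K]_n.+1, v^H *m v = 1%:M & A *m v = of_real c a *: v.
Proof.
move=> Ah; have [a] := hermitian_char_root Ah.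
rewrite -eigenvalue_root_char => /eigenvalueP[v vA v0].
have [|b _ uu] := @unit_multiple R c n.+1 v^H.
  by apply: contra v0 => /eqP v0; rewrite -[v]adjmxK v0 adjmx0.
exists a, (of_real c b *: v^H) => //.
rewrite -scalemxAr [RHS]scalerA mulrC -[RHS]scalerA; congr (_ *: _).
by rewrite -[LHS]adjmxK adjmxM adjmxK Ah vA adjmxZ conjs_of_real.
Qed.

(** Deflation: in a unitary basis starting with a unit eigenvector, the first column is a multiple
    of the first basis vector, self-adjointness clears the first row as well, and the lower right
    block is handled by induction. *)
Lemma spectral_theorem n (A : 'M[K]_n) : A^H = A ->
  exists f, exists2 V : 'M[K]_n, unitary V & A = V *m rdiag c n n f *m V^H.
Proof.
elim: n A => [A _|n IH A Ah].
  by exists (fun=> 0), 1%:M; [exact: unitary1 | apply/matrixP => -[]].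
have [a [u uu Au]] := hermitian_eigenvector Ah.
have [V Vu uV] := orthonormal_complete uu.
pose B : 'M[K]_(1 + n) := V^H *m A *m V.
have Bh : B^H = B by rewrite !adjmxM adjmxK Ah mulmxA.
have Be : B *m rdiag c n.+1 1 (fun=> 1) = of_real c a *: rdiag c n.+1 1 (fun=> 1).
  by rewrite -mulmxA -uV -mulmxA Au -scalemxAr uV mulmxA Vu mul1mx.
have B_col i : B i 0 = if i == 0 then of_real c a else 0.
  move/matrixP: Be => /(_ i 0); rewrite mul_mx_rdiagE.
  case: insubP => // k _ k0; have -> : k = 0 by apply: val_inj.
  by rewrite !mxE rmorph1 mulr1 => ->; rewrite -val_eqE; case: ifP; rewrite ?mulr1 ?mulr0.
have AB : A = V *m B *m V^H.
  by rewrite !mulmxA unitary_mulV // mul1mx -mulmxA unitary_mulV // mulmx1.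
clearbody B; have [|g [W Wu BW]] := IH (drsubmx B).
  by rewrite -[in RHS]Bh; apply/matrixP => i j; rewrite !mxE.
pose Y : 'M[K]_(1 + n) := block_mx 1%:M 0 0 W.
have Yh : Y^H = block_mx 1%:M 0 0 W^H.
  by rewrite /adjmx tr_block_mx map_block_mx !trmx0 !map_mx0 trmx1 map_mx1.
have Yu : unitary Y.
  rewrite /unitary Yh mulmx_block !(mul0mx, mulmx0, mul1mx, addr0, add0r).
  by rewrite Wu -scalar_mx_block.
have BY : B = Y *m rdiag c (1 + n) (1 + n) (fun i => if i is i'.+1 then g i' else a) *m Y^H.
  have -> : rdiag c (1 + n) (1 + n) (fun i => if i is i'.+1 then g i' else a)
      = block_mx (of_real c a)%:M 0 0 (rdiag c n n g).
    apply/matrixP => i j; rewrite -(splitK i) -(splitK j).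
    case: (fintype.split i) => i'; case: (fintype.split j) => j' /=;
      by rewrite ?block_mxEul ?block_mxEur ?block_mxEdl ?block_mxEdr !mxE ?ord1.
  rewrite Yh !mulmx_block !(mul0mx, mulmx0, mul1mx, mulmx1, addr0, add0r) -BW.
  have l0 : lshift n 0 = 0 :> 'I_(1 + n) by apply: val_inj.
  rewrite -[LHS]submxK; congr block_mx; apply/matrixP => i j; rewrite !mxE ?ord1 l0.
  - by rewrite B_col eqxx mulr1n.
  - by rewrite -Bh adjmxE B_col rmorph0.
  - by rewrite B_col.
exists (fun i => if i is i'.+1 then g i' else a), (V *m Y); last first.
  by rewrite AB BY adjmxM !mulmxA.
exact: unitaryM.
Qed.

Lemma spectral_theorem_sorted n (A : 'M[K]_n) : A^H = A ->
  exists f, exists2 V : 'M[K]_n, unitary V &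
    A = V *m rdiag c n n f *m V^H /\ forall i j, (i <= j < n)%N -> f j <= f i.
Proof.
move=> Ah; have [f [V Vu AV]] := spectral_theorem Ah.
pose t0 := [tuple f i | i < n]; pose s := sort >=%R t0.
have ss : size s = n by rewrite size_sort size_tuple.
have : perm_eq (tcast ss (in_tuple s)) t0 by rewrite val_tcast perm_sort.
case/tuple_permP => p sp; rewrite val_tcast /= in sp.
have sE (i : 'I_n) : s`_i = f (p i).
  by rewrite sp -(tnth_nth 0 [tuple tnth t0 (p k) | k < n]) !tnth_mktuple.
exists (nth 0 s), (\matrix_(i, j) V i (p j)).
  apply/matrixP => i j; rewrite mxE; transitivity ((V^H *m V) (p i) (p j)).
    by rewrite mxE; apply: eq_bigr => k _; rewrite !adjmxE !mxE.
  by rewrite Vu !mxE (inj_eq perm_inj).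
split.
  rewrite AV; apply/matrixP => i j; rewrite !mxE (reindex_inj (@perm_inj _ p)) /=.
  apply: eq_bigr => k _; rewrite !mul_mx_rdiagE !valK !adjmxE !mxE; congr (_ * _ * _).
  by rewrite sE.
move=> i j /andP[leij ltjn].
have : sorted >=%R s by apply: sort_sorted => x y; exact: le_total.
move/(sorted_leq_nth (fun y x z (xy : y <= x) (zy : z <= y) => le_trans zy xy)
                     (fun x => lexx x)).
by move=> /(_ 0 i j); rewrite !inE ss; apply => //; exact: leq_ltn_trans ltjn.
Qed.

(** If [V] diagonalises [A^H *m A], then [A *m V] has a diagonal Gram matrix and factors as a
    unitary times the square roots of its entries. *)
Lemma svd_tall m n (A : 'M[K]_(m, n)) : (n <= m)%N ->
  exists s, is_singular_values A s.
Proof.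
move=> lenm; have [|f [V Vu [AV fs]]] := @spectral_theorem_sorted n (A^H *m A).
  by rewrite adjmxM adjmxK.
have GV : (A *m V)^H *m (A *m V) = rdiag c n n f.
  by rewrite adjmxM mulmxA -(mulmxA _ _ A) AV !mulmxA Vu mul1mx -mulmxA Vu mulmx1.
have f0 i : (i < n)%N -> 0 <= f i.
  move=> ltin; have [a a0] := gram_diag_real (A *m V) (Ordinal ltin).
  by rewrite GV mxE eqxx => /of_real_inj ->.
have [|U Uu AVU] := @gram_factor _ _ m n (fun i => Num.sqrt (f i)) (A *m V) lenm.
  by rewrite GV; apply: eq_rdiag => i ltin _; rewrite sqr_sqrtr // f0.
exists (mkseq (fun i => Num.sqrt (f i)) n); split.
- by rewrite size_mkseq (minn_idPr lenm).
- apply/(sortedP 0) => i; rewrite size_mkseq => ltin.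
  rewrite !nth_mkseq ?(ltnW ltin) //.
  by apply: ler_wsqrtr; apply: fs; rewrite leqnSn.
- by apply/allP => x /mapP[i _ ->]; exact: sqrtr_ge0.
exists U, V; split=> //; rewrite -[LHS]mulmx1 -(unitary_mulV Vu) mulmxA AVU.
congr (_ *m _ *m _); apply/matrixP => i j; rewrite !mxE.
by case: eqP => // ->; rewrite nth_mkseq.
Qed.

(** Wide matrices go through the adjoint, which swaps [U] and [V] and keeps the list. *)
Lemma singular_valuesP m n (A : 'M[K]_(m, n)) : is_singular_values A (singular_values A).
Proof.
apply: xgetPex; have [/svd_tall //|/ltnW lemn] := leqP n m.
have [s [ss so s0 [U [V [Uu Vu AUV]]]]] := svd_tall A^H lemn.
exists s; split=> //; first by rewrite minnC.
exists V, U; split=> //; rewrite -[LHS]adjmxK AUV !adjmxM adjmxK mulmxA.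
congr (_ *m _ *m _); exact: (rdiag_adj c).
Qed.

Lemma svd m n (A : 'M[K]_(m, n)) : let s := singular_values A in
  [/\ size s = minn m n, forall i, 0 <= s`_i &
    exists2 U : 'M[K]_m, unitary U & exists2 V : 'M[K]_n, unitary V &
      A = U *m rdiag c m n (nth 0 s) *m V^H].
Proof.
move=> s; have [ss _ /allP s0 [U [V [Uu Vu AUV]]]] := singular_valuesP A.
split=> //; last by exists U => //; exists V.
move=> i; have [ltis|leis] := ltnP i (size s); last by rewrite nth_default.
exact/s0/mem_nth.
Qed.

End SpectralTheorem.

(** * Unitarily invariant norms under multiplication *)

Section UnitarilyInvariantNorms.
Variables (R : realType) (c : scalar_kind) (n : nat).
Local Notation K := (scalars R c).
Implicit Types (M U P : 'M[K]_n) (f : nat -> R).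

Lemma modulus_conjs (x : K) : modulus (conjs x) = modulus x.
Proof.
have := mul_conjs (conjs x); rewrite conjsK mulrC mul_conjs => /of_real_inj /eqP.
by rewrite eqrXn2 ?modulus_ge0 // => /eqP.
Qed.

Lemma uinorm_adj (N : 'M[K]_n -> R) :
  unitarily_invariant_norm N -> unitarily_invariant_norm (fun M => N M^H).
Proof.
case=> Ndef Nscale Ntri Nunit; split.
- by move=> M /Ndef M0; rewrite -[M]adjmxK M0 adjmx0.
- by move=> a M; rewrite adjmxZ Nscale modulus_conjs.
- by move=> M M'; rewrite adjmxD.
- move=> U V M Uu Vu; rewrite !adjmxM mulmxA Nunit //; exact: unitary_adj.
Qed.

Lemma unitary_diag (u : 'rV[K]_n) : (forall i, modulus (u 0 i) = 1) -> unitary (diag_mx u).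
Proof.
move=> u1; apply/matrixP => i j; rewrite mul_mx_diag !mxE.
case: (eqVneq i j) => _.
  by rewrite mulr1n mulrC mul_conjs u1 expr1n rmorph1.
by rewrite mulr0n rmorph0 mul0r.
Qed.

Lemma unitary_rdiag f : (forall i, (i < n)%N -> f i ^+ 2 = 1) -> unitary (rdiag c n n f).
Proof.
move=> f1; rewrite /unitary rdiag_adj rdiagMs -rdiag1.
by apply: eq_rdiag => i ltin _; rewrite -expr2 f1.
Qed.

Variables (N : 'M[K]_n -> R) (Nui : unitarily_invariant_norm N).

Lemma uinormZ a M : N (of_real c a *: M) = `|a| * N M.
Proof. by rewrite (uinorm_scale Nui) modulus_of_real. Qed.

Lemma uinorm0 : N 0 = 0.
Proof. by rewrite -(scale0r 0) (uinorm_scale Nui) modulus0 mul0r. Qed.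

Lemma uinormN M : N (- M) = N M.
Proof.
by rewrite -scaleN1r -(rmorph1 (of_real c)) -rmorphN uinormZ normrN normr1 mul1r.
Qed.

Lemma uinorm_ge0 M : 0 <= N M.
Proof. by have := uinorm_triangle Nui M (- M); rewrite subrr uinorm0 uinormN; lra. Qed.

Lemma uinorm_unitaryl U M : unitary U -> N (U *m M) = N M.
Proof. by move=> Uu; rewrite -[U *m M]mulmx1 (uinorm_unitary Nui) //; exact: unitary1. Qed.

Lemma uinorm_unitaryr U M : unitary U -> N (M *m U) = N M.
Proof. by move=> Uu; rewrite -[M in LHS]mul1mx (uinorm_unitary Nui) //; exact: unitary1. Qed.

(** The factor is a convex combination of 1 and [U]. Where [U] acts as -1 it acts as (1 + a)/2 - (1
    - a)/2 = a, which explains the weights. *)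
Lemma uinorm_convex a U M : 0 <= a <= 1 -> unitary U ->
  N ((of_real c ((1 + a) / 2) *: 1%:M + of_real c ((1 - a) / 2) *: U) *m M) <= N M.
Proof.
move=> /andP[a0 a1] Uu; rewrite mulmxDl -!scalemxAl mul1mx.
apply: le_trans (uinorm_triangle Nui _ _) _.
by rewrite !uinormZ uinorm_unitaryl // !ger0_norm; have := uinorm_ge0 M; nra.
Qed.

(** [P] is the average of 1 and the reflection 2P - 1, which is unitary: the case a = 0. *)
Lemma uinorm_projl P M : P^H = P -> P *m P = P -> N (P *m M) <= N M.
Proof.
move=> Ph PP; have Uu : unitary (2 *: P - 1%:M).
  rewrite /unitary adjmxB adjmxZ adjmx1 Ph rmorph_nat.
  rewrite mulmxBl mulmxBr mul1mx mulmx1 -scalemxAl -scalemxAr PP.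
  rewrite scaler_nat [in X in X - _ - _]scaler_nat.
  by apply/matrixP => i j; rewrite !mxE; ring.
have PE : P = of_real c ((1 + 0) / 2) *: 1%:M + of_real c ((1 - 0) / 2) *: (2 *: P - 1%:M).
  rewrite addr0 subr0 scalerBr scalerA addrC subrK -(rmorph_nat (of_real c)) -rmorphM.
  by rewrite mul1r mulVf ?rmorph1 ?scale1r // pnatr_eq0.
by rewrite [P in P *m M]PE; apply: uinorm_convex; rewrite ?lexx ?ler01.
Qed.

(** One coordinate at a time: scaling coordinate [m] by [f m] averages the identity with the sign
    change of that coordinate. *)
Lemma uinorm_rdiagl f M : (forall i, (i < n)%N -> 0 <= f i <= 1) ->
  N (rdiag c n n f *m M) <= N M.
Proof.
move=> f01; pose g m i := if (i < m)%N then f i else 1.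
suff h m : (m <= n)%N -> N (rdiag c n n (g m) *m M) <= N M.
  rewrite (_ : rdiag c n n f = rdiag c n n (g n)) ?h //.
  by apply: eq_rdiag => i ltin _; rewrite /g ltin.
elim: m => [_|m IH ltmn].
  by rewrite (_ : rdiag c n n (g 0%N) = 1%:M) ?mul1mx // -rdiag1.
apply: le_trans (IH (ltnW ltmn)).
have -> : rdiag c n n (g m.+1) = (of_real c ((1 + f m) / 2) *: 1%:M +
    of_real c ((1 - f m) / 2) *: rdiag c n n (fun i => if i == m then - 1 else 1))
    *m rdiag c n n (g m).
  apply/matrixP => i j; rewrite mul_mx_rdiagE valK !mxE -val_eqE /g ltnS leq_eqVlt.
  case: (eqVneq (i : nat) j) => [->|ij]; last by rewrite !mulr0 addr0 mul0r.
  rewrite -[1%:R](rmorph1 (of_real c)) -!rmorphM -rmorphD -rmorphM; congr of_real.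
  by case: (eqVneq (j : nat) m) => [->|_] /=; rewrite ?ltnn; field.
rewrite -mulmxA; apply: uinorm_convex; first exact: f01.
by apply: unitary_rdiag => i _; case: ifP; rewrite ?sqrrN expr1n.
Qed.

(** Each entry is [s] times a number in [0, 1] times a phase, the phase being set to 1 at zero
    entries so that the phases form a unitary matrix. *)
Lemma uinorm_diagl (d : 'rV[K]_n) s M :
  0 <= s -> (forall i, modulus (d 0 i) <= s) -> N (diag_mx d *m M) <= s * N M.
Proof.
rewrite le0r => /orP[/eqP-> d0|s0 ds].
  rewrite (_ : d = 0) ?linear0 ?mul0mx ?uinorm0 ?mul0r //.
  apply/matrixP => i j; rewrite ord1 mxE; apply/eqP.
  by rewrite -modulus_eq0 eq_le d0 modulus_ge0.
pose u : 'rV[K]_n := \row_i if d 0 i == 0 then 1 else d 0 i / of_real c (modulus (d 0 i)).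
have Uu : unitary (diag_mx u).
  apply: unitary_diag => i; rewrite mxE; case: eqVneq => [_|di].
    by rewrite -(rmorph1 (of_real c)) modulus_of_real normr1.
  rewrite modulusM modulusV modulus_of_real ger0_norm ?modulus_ge0 // divff //.
  by rewrite modulus_eq0.
pose f i := if insub i is Some k then modulus (d 0 k) / s else 0.
have -> : diag_mx d = of_real c s *: (rdiag c n n f *m diag_mx u).
  apply/matrixP => i j; rewrite mul_mx_diag !mxE -val_eqE /f valK /=.
  case: (eqVneq (i : nat) j) => [/val_inj ij|]; last by rewrite mul0r mulr0.
  rewrite -ij mulr1n; case: eqVneq => [->|di].
    by rewrite modulus0 mul0r rmorph0 mul0r mulr0.
  rewrite rmorphM fmorphV.
  have sn : of_real c s != 0 by rewrite fmorph_eq0 gt_eqF.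
  have mn : of_real c (modulus (d 0 i)) != 0 by rewrite fmorph_eq0 modulus_eq0.
  by rewrite [_ * (of_real c s)^-1]mulrC -mulrA mulVKf // mulrC divfK.
rewrite -scalemxAl uinormZ gtr0_norm // ler_pM2l // -mulmxA.
rewrite -[leRHS](uinorm_unitaryl _ Uu); apply: uinorm_rdiagl => i ltin.
rewrite /f insubT /= divr_ge0 ?modulus_ge0 ?(ltW s0) //=.
by rewrite ler_pdivrMr // mul1r.
Qed.

(** Completing [E] to a unitary [V] gives [M *m V] the Gram matrix diag(f^2), so it is a unitary
    times diag(f). This identifies both angle matrices with norms of explicit operators. *)
Lemma uinorm_gram m (E : 'M[K]_(n, m)) M f :
    E^H *m E = 1%:M -> (forall i, (m <= i)%N -> f i = 0) ->
  M^H *m M = E *m rdiag c m m (fun i => f i ^+ 2) *m E^H -> N M = N (rdiag c n n f).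
Proof.
move=> EE f0 MM; have [V Vu EV] := orthonormal_complete EE.
have [|U Uu MV] := @gram_factor_square _ _ n f (M *m V).
  rewrite adjmxM mulmxA -(mulmxA _ _ M) MM EV adjmxM rdiag_adj.
  rewrite !mulmxA Vu mul1mx -!mulmxA Vu mulmx1.
  rewrite rdiagMs rdiagM => [|i lemi _ _]; last by rewrite f0 // expr0n mul0r mulr0.
  by apply: eq_rdiag => i _ _; rewrite mul1r mulr1.
by rewrite -(uinorm_unitaryr _ Vu) MV uinorm_unitaryl.
Qed.

End UnitarilyInvariantNorms.

(** * The same bounds for right factors, by adjunction *)

Section RightMultiplication.
Variables (R : realType) (c : scalar_kind) (n : nat).
Local Notation K := (scalars R c).
Variables (N : 'M[K]_n -> R) (Nui : unitarily_invariant_norm N).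

Lemma uinorm_projr (P M : 'M[K]_n) : P^H = P -> P *m P = P -> N (M *m P) <= N M.
Proof.
move=> Ph PP; have := uinorm_projl (uinorm_adj Nui) M^H Ph PP.
by rewrite adjmxM Ph adjmxK.
Qed.

Lemma uinorm_diagr (d : 'rV[K]_n) s (M : 'M[K]_n) :
  0 <= s -> (forall i, modulus (d 0 i) <= s) -> N (M *m diag_mx d) <= s * N M.
Proof.
move=> s0 ds; have := @uinorm_diagl _ _ _ _ (uinorm_adj Nui) (map_mx conjs d) s M^H s0.
rewrite adjmxM adjmxK /adjmx tr_diag_mx map_diag_mx.
rewrite (_ : map_mx conjs (map_mx conjs d) = d).
  by apply => i; rewrite mxE modulus_conjs.
by apply/matrixP => i j; rewrite !mxE conjsK.
Qed.

End RightMultiplication.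

(** * Orthogonal projections and dimension counts *)

Section OrthogonalProjections.
Variables (R : realType) (c : scalar_kind) (n : nat).
Local Notation K := (scalars R c).
Implicit Types (S T W U : {vspace 'cV[K]_n}) (v w : 'cV[K]_n).

Definition rind m (b : pred nat) : 'M[K]_m := rdiag c m m (fun i => (b i)%:R).

Lemma rind_adj m b : (rind m b)^H = rind m b.
Proof. exact: rdiag_adj. Qed.

Lemma rindM m b b' : rind m b *m rind m b' = rind m (predI b b').
Proof. by rewrite /rind rdiagMs; apply: eq_rdiag => i _ _; rewrite -natrM mulnb. Qed.

Lemma mem_lker_mulmx m (M : 'M[K]_(m, n)) v :
  (v \in lker (linfun (mulmx M : 'cV[K]_n -> 'cV[K]_m))) = (M *m v == 0).
Proof. by rewrite memv_ker lfunE. Qed.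

Lemma mem_colspan_mul p (E : 'M[K]_(n, p)) (b : pred nat) (a : 'cV[K]_p) :
  (forall i : 'I_p, ~~ b i -> a i 0 = 0) -> E *m a \in colspan E b.
Proof.
move=> ab; have -> : E *m a = \sum_i a i 0 *: col i E.
  by apply/matrixP => i j; rewrite ord1 mxE summxE; apply: eq_bigr => l _; rewrite !mxE mulrC.
apply: memv_suml => i _; have [bi|/ab->] := boolP (b i); last by rewrite scale0r mem0v.
by apply/memvZ/memv_span/map_f; rewrite mem_filter bi mem_enum.
Qed.

Lemma colspan_sub p (E : 'M[K]_(n, p)) (b : pred nat) W :
  (forall i : 'I_p, b i -> col i E \in W) -> (colspan E b <= W)%VS.
Proof.
move=> EW; apply/span_subvP/allP; rewrite all_map; apply/allP => i.
by rewrite mem_filter => /andP[/EW].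
Qed.

Lemma mem_colspan p (E : 'M[K]_(n, p)) (b : pred nat) v : E^H *m E = 1%:M ->
  (v \in colspan E b) = (E *m rind p b *m E^H *m v == v).
Proof.
move=> EE; apply/idP/eqP => [|<-]; last first.
  rewrite -!mulmxA; apply: mem_colspan_mul => i bi.
  by rewrite mxE big1 // => l _; rewrite mxE (negPf bi) rmorph0 if_same mul0r.
pose L := lker (linfun (mulmx (E *m rind p b *m E^H - 1%:M) : 'cV[K]_n -> 'cV[K]_n)).
suff /subvP sub : (colspan E b <= L)%VS.
  by move=> /sub; rewrite mem_lker_mulmx mulmxBl mul1mx subr_eq0 => /eqP.
apply: colspan_sub => i bi.
rewrite mem_lker_mulmx mulmxBl mul1mx subr_eq0 colE -!mulmxA (mulmxA _ E) EE mul1mx.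
apply/eqP; congr (_ *m _); apply/matrixP => k l; rewrite ord1 -colE !mxE.
by case: (eqVneq k i) => [->|ki]; rewrite ?eqxx ?bi ?rmorph1 // [_ == _](negPf ki).
Qed.

(** Symmetric orthogonalisation in the eigenbasis: if M^H M = V diag(f) V^H, injectivity makes every
    [f i] positive, and B = M V diag(f)^{-1/2} has orthonormal columns with the same span. *)
Lemma injective_orthonormalize d (M : 'M[K]_(n, d)) :
  (forall a : 'cV[K]_d, M *m a = 0 -> a = 0) ->
  exists2 B : 'M[K]_(n, d), B^H *m B = 1%:M &
    exists2 C : 'M[K]_d, B = M *m C & exists C' : 'M[K]_d, M = B *m C'.
Proof.
move=> M_inj.
have [|f [V Vu MM]] := @spectral_theorem R c _ (M^H *m M); first by rewrite adjmxM adjmxK.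
pose G := M *m V; have GG : G^H *m G = rdiag c _ _ f.
  by rewrite adjmxM mulmxA -(mulmxA _ _ M) MM !mulmxA Vu mul1mx -mulmxA Vu mulmx1.
have f_gt0 i : (i < d)%N -> 0 < f i.
  move=> ltid; pose k := Ordinal ltid.
  have [a a0] := gram_diag_real G k; rewrite GG mxE eqxx => /of_real_inj fa.
  rewrite lt_def {2}fa a0 andbT; apply/eqP => f0.
  have /M_inj Vk0 : M *m (V *m delta_mx k 0) = 0 :> 'cV_n.
    rewrite mulmxA -colE; apply/matrixP => l j; rewrite [LHS]mxE [RHS]mxE.
    by apply: gram_diag_eq0; rewrite GG mxE eqxx f0 rmorph0.
  have /matrixP/(_ k 0)/eqP : V^H *m (V *m delta_mx k 0) = 0 :> 'cV_d by rewrite Vk0 mulmx0.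
  by rewrite mulmxA Vu mul1mx !mxE !eqxx oner_eq0.
exists (G *m rdiag c _ _ (fun i => (Num.sqrt (f i))^-1)).
  rewrite adjmxM rdiag_adj mulmxA -(mulmxA _ _ G) GG !rdiagMs -rdiag1.
  apply: eq_rdiag => i ltid _; have f0 := f_gt0 _ ltid.
  by rewrite mulrAC -invfM -expr2 sqr_sqrtr ?ltW // mulVf // gt_eqF.
exists (V *m rdiag c _ _ (fun i => (Num.sqrt (f i))^-1)); first by rewrite mulmxA.
exists (rdiag c _ _ (fun i => Num.sqrt (f i)) *m V^H).
rewrite mulmxA -(mulmxA G) rdiagMs.
rewrite (_ : rdiag _ _ _ _ = 1%:M); first by rewrite mulmx1 -mulmxA unitary_mulV ?mulmx1.
rewrite -rdiag1; apply: eq_rdiag => k ltkd _.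
by rewrite mulVf // sqrtr_eq0 -ltNge f_gt0.
Qed.

Lemma is_onbasis_exists W : exists B : 'M[K]_(n, \dim W), is_onbasis B.
Proof.
have [M MaE colM] : exists2 M : 'M[K]_(n, \dim W),
    forall a : 'cV[K]_(\dim W), M *m a = \sum_i a i 0 *: (vbasis W)`_i &
    forall i, col i M = (vbasis W)`_i.
  exists (\matrix_(i, j) (vbasis W)`_j i 0) => [a|i].
    apply/matrixP => i j; rewrite ord1 mxE summxE; apply: eq_bigr => l _.
    by rewrite !mxE mulrC.
  by apply/matrixP => k l; rewrite ord1 !mxE.
have [a Ma0|B BB [C BM [C' MB]]] := injective_orthonormalize (M := M).
  apply/matrixP => i j; rewrite ord1 mxE.
  have /freeP/(_ (fun i => a i 0)) := basis_free (vbasisP W).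
  by apply; rewrite -[RHS]Ma0; exact/esym/MaE.
exists B; split=> //; apply/eqP; rewrite eqEsubv; apply/andP; split.
  apply: colspan_sub => i _; rewrite colE BM -mulmxA MaE.
  apply: memv_suml => j _; apply/memvZ/vbasis_mem.
  by apply: mem_nth; rewrite size_tuple.
rewrite -{1}(span_basis (vbasisP W)); apply/span_subvP/allP/(all_nthP 0) => i.
rewrite size_tuple => ltiW; rewrite -(colM (Ordinal ltiW)) colE MB -mulmxA.
exact: mem_colspan_mul.
Qed.

Lemma onbasisP W : is_onbasis (onbasis W).
Proof. by apply: xgetPex; exact: is_onbasis_exists. Qed.

Lemma onbasis_orthonormal W : (onbasis W)^H *m onbasis W = 1%:M.
Proof. by case: (onbasisP W). Qed.

Definition orthproj W : 'M[K]_n := onbasis W *m (onbasis W)^H.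

Lemma proj_adj W : (orthproj W)^H = orthproj W.
Proof. by rewrite adjmxM adjmxK. Qed.

Lemma proj_idem W : orthproj W *m orthproj W = orthproj W.
Proof. by rewrite /orthproj mulmxA -(mulmxA _ _ (onbasis W)) onbasis_orthonormal mulmx1. Qed.

Lemma mem_proj W v : (v \in W) = (orthproj W *m v == v).
Proof.
have [BB {1}<-] := onbasisP W; rewrite mem_colspan // /rind.
by rewrite (_ : rdiag _ _ _ _ = 1%:M) ?mulmx1 // -rdiag1; apply: eq_rdiag.
Qed.

Lemma proj_fix W v : v \in W -> orthproj W *m v = v.
Proof. by rewrite mem_proj => /eqP. Qed.

Lemma proj_mem W v : orthproj W *m v \in W.
Proof. by rewrite mem_proj mulmxA proj_idem. Qed.

Lemma eq_mulmx_cV m (A B : 'M[K]_(m, n)) : (forall v, A *m v = B *m v) -> A = B.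
Proof.
move=> AB; apply/matrixP => i j; have /matrixP/(_ i 0) := AB (delta_mx j 0).
by rewrite -!colE !mxE.
Qed.

Lemma proj_uniq W P : P^H = P -> (forall v, P *m v \in W) ->
  (forall v, v \in W -> P *m v = v) -> orthproj W = P.
Proof.
move=> Ph PW Pfix.
have e1 : orthproj W *m P = P by apply: eq_mulmx_cV => v; rewrite -mulmxA proj_fix.
have e2 : P *m orthproj W = orthproj W.
  by apply: eq_mulmx_cV => v; rewrite -mulmxA Pfix // proj_mem.
by rewrite -e2 -{1}Ph -[orthproj W in LHS]proj_adj -adjmxM e1.
Qed.

Lemma proj_colspan (X : 'M[K]_n) b : unitary X ->
  orthproj (colspan X b) = X *m rind n b *m X^H.
Proof.
move=> Xu; have idem : X *m rind n b *m X^H *m (X *m rind n b *m X^H) = X *m rind n b *m X^H.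
  rewrite -!mulmxA (mulmxA _ X) Xu mul1mx (mulmxA (rind n b)) rindM.
  by congr (_ *m (_ *m _)); apply: eq_rdiag => i _ _ /=; rewrite andbb.
apply: proj_uniq => [|v|v].
- by rewrite !adjmxM adjmxK rind_adj mulmxA.
- by rewrite mem_colspan // mulmxA idem.
- by rewrite mem_colspan // => /eqP.
Qed.

Lemma projM_sub S T : (S <= T)%VS -> orthproj T *m orthproj S = orthproj S.
Proof.
move=> /subvP ST; apply: eq_mulmx_cV => v.
by rewrite -mulmxA proj_fix // ST // proj_mem.
Qed.

Lemma projM_subr S T : (S <= T)%VS -> orthproj S *m orthproj T = orthproj S.
Proof. by move=> /projM_sub e; rewrite -[LHS]adjmxK adjmxM !proj_adj e proj_adj. Qed.

Lemma mem_orthc W v : (v \in orthc W) = (orthproj W *m v == 0).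
Proof.
have innE u w : inner u w = (w^H *m u) 0 0.
  by rewrite innerE mxE; apply: eq_bigr => i _; rewrite adjmxE mulrC.
apply/mem_orthovP/eqP => [vW|Wv w wW].
  apply: gram_eq0; rewrite adjmxM proj_adj mulmxA -(mulmxA _ _ (orthproj W)) proj_idem.
  rewrite -[orthproj W]proj_adj -adjmxM.
  by apply/matrixP => i j; rewrite !ord1 -innE vW ?proj_mem // mxE.
by rewrite [LHS]innE -(proj_fix wW) adjmxM proj_adj -mulmxA Wv mulmx0 mxE.
Qed.

Lemma orthcP W v : reflect (forall w, w \in W -> w^H *m v = 0) (v \in orthc W).
Proof.
rewrite mem_orthc; apply: (iffP eqP) => [Wv w wW|vW].
  by rewrite -(proj_fix wW) adjmxM proj_adj -mulmxA Wv mulmx0.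
apply: gram_eq0; rewrite adjmxM proj_adj mulmxA -(mulmxA _ _ (orthproj W)) proj_idem.
by rewrite -[orthproj W]proj_adj -adjmxM vW // proj_mem.
Qed.

Lemma mxtrace_proj W : \tr (orthproj W) = (\dim W)%:R.
Proof. by rewrite mxtrace_mulC onbasis_orthonormal mxtrace1. Qed.

(** The trace of a projection determines the dimension, the field having characteristic 0;
    dimensions are thus read off matrix identities. *)
Lemma dim_proj W P : orthproj W = P -> forall d : nat, \tr P = d%:R -> \dim W = d.
Proof. by move=> <- d; rewrite mxtrace_proj => /eqP; rewrite eqr_nat => /eqP. Qed.

Lemma dim_colspan (X : 'M[K]_n) (b : pred nat) : unitary X ->
  \dim (colspan X b) = (\sum_(i < n) b i)%N.
Proof.
move=> Xu; apply: (dim_proj (proj_colspan b Xu)).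
rewrite mxtrace_mulC mulmxA Xu mul1mx natr_sum; apply: eq_bigr => i _.
by rewrite mxE eqxx rmorph_nat.
Qed.

Lemma mem_mximage (M : 'M[K]_n) W v :
  reflect (exists2 w, w \in W & v = M *m w) (v \in mximage M W).
Proof.
by apply: (iffP memv_imgP) => -[w wW ->]; exists w; rewrite ?lfunE.
Qed.

Lemma mximage_mem (M : 'M[K]_n) W v : v \in W -> M *m v \in mximage M W.
Proof. by move=> vW; apply/mem_mximage; exists v. Qed.

Lemma mximageM (M M' : 'M[K]_n) W : mximage (M *m M') W = mximage M (mximage M' W).
Proof.
apply/vspaceP => v; apply/mem_mximage/mem_mximage => [[w wW ->]|[_ /mem_mximage[w wW ->] ->]].
  by exists (M' *m w); rewrite ?mximage_mem ?mulmxA.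
by exists w; rewrite ?mulmxA.
Qed.

Lemma dim_mximage (M : 'M[K]_n) W :
  (forall w, w \in W -> M *m w = 0 -> w = 0) -> \dim (mximage M W) = \dim W.
Proof.
move=> M_inj; apply: limg_dim_eq; apply/eqP; rewrite -subv0; apply/subvP => w.
by rewrite memv_cap mem_lker_mulmx memv0 => /andP[/M_inj Mw /eqP/Mw ->].
Qed.

(** Rank-nullity for the projection to [T] restricted to [W]. *)
Lemma dim_orthc_cap W T :
  (\dim (W :&: orthc T) + \dim (mximage (orthproj T) W))%N = \dim W.
Proof.
rewrite -(limg_ker_dim (linfun (mulmx (orthproj T) : 'cV[K]_n -> 'cV[K]_n)) W).
congr (\dim (_ :&: _) + _)%N; apply/vspaceP => v.
by rewrite mem_orthc mem_lker_mulmx.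
Qed.

(** For [s] in [S], the residual of [s] after projection to P_S(H) lies in [S] and is orthogonal to
    P_S(H), hence to [H], so it is zero. *)
Lemma mximage_proj_full H S : (orthc H :&: S = 0)%VS -> mximage (orthproj S) H = S.
Proof.
move=> HS0; apply/eqP; rewrite eqEsubv; apply/andP; split; apply/subvP => s.
  by case/mem_mximage => w _ ->; exact: proj_mem.
move=> sS; set U := mximage _ _; pose u := s - orthproj U *m s.
have US : (U <= S)%VS by apply/subvP => _ /mem_mximage[w _ ->]; exact: proj_mem.
have uS : u \in S by rewrite memvB // (subvP US) // proj_mem.
suff u0 : u = 0.
  by rewrite mem_proj eq_sym -subr_eq0; apply/eqP.
apply/eqP; rewrite -memv0 -HS0 memv_cap uS andbT; apply/orthcP => w wH.
have uU : u \in orthc U by rewrite mem_orthc mulmxBr mulmxA proj_idem subrr.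
by rewrite -(proj_fix uS) mulmxA -[orthproj S]proj_adj -adjmxM (orthcP _ _ uU) // mximage_mem.
Qed.

Lemma exists_subspace W d : (d <= \dim W)%N ->
  exists2 U : {vspace 'cV[K]_n}, (U <= W)%VS & \dim U = d.
Proof.
move=> led; exists <<take d (vbasis W)>>%VS.
  by apply/span_subvP => v /mem_take; exact: vbasis_mem.
have /basis_free : basis_of W (vbasis W) := vbasisP W.
rewrite -{1}(cat_take_drop d (vbasis W)) => /catl_free /eqP ->.
by rewrite size_takel // size_tuple.
Qed.

End OrthogonalProjections.

(** * Sines and tangents of principal angles as operators *)

Section PrincipalAngles.
Variables (R : realType) (c : scalar_kind) (n : nat).
Local Notation K := (scalars R c).
Implicit Types (S T H : {vspace 'cV[K]_n}).

Lemma compl_proj_gram S (G : 'M[K]_n) :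
  ((1%:M - orthproj S) *m G)^H *m ((1%:M - orthproj S) *m G) = G^H *m (1%:M - orthproj S) *m G.
Proof.
rewrite adjmxM adjmxB adjmx1 proj_adj !mulmxA -(mulmxA _ _ (1%:M - _)); congr (_ *m _ *m _).
by rewrite mulmxBr mulmx1 mulmxBl mul1mx proj_idem subrr subr0.
Qed.

Variant principal_decomposition S T (s : seq R) : Prop :=
  PrincipalDecomposition (U : 'M[K]_(\dim S)) (V : 'M[K]_(\dim T)) of
    unitary U & unitary V & size s = minn (\dim S) (\dim T) &
    (forall i, 0 <= s`_i <= 1) &
    (onbasis S)^H *m onbasis T = U *m rdiag c (\dim S) (\dim T) (nth 0 s) *m V^H.

(** The bound s_i <= 1 holds because 1 - s_i^2 is a diagonal entry of the Gram matrix of (1 - P_S) Q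
    V. *)
Lemma principal_decompositionP S T :
  principal_decomposition S T (singular_values ((onbasis S)^H *m onbasis T)).
Proof.
set E := onbasis S; set Q := onbasis T.
have [ss s0 [U Uu [V Vu EQ]]] := svd (E^H *m Q).
exists U V => // i; rewrite s0 /=; set s := singular_values _ in ss s0 EQ *.
have [leTi|ltiT] := leqP (\dim T) i.
  by rewrite nth_default ?ler01 // ss geq_min leTi orbT.
have QE : Q^H *m E = (E^H *m Q)^H by rewrite adjmxM adjmxK.
have ZZ : ((1%:M - orthproj S) *m Q *m V)^H *m ((1%:M - orthproj S) *m Q *m V) =
    rdiag c _ _ (fun i => 1 - s`_i * s`_i).
  rewrite -mulmxA adjmxM adjmxB adjmx1 proj_adj !mulmxA -(mulmxA _ _ (1%:M - _)).
  rewrite [(1%:M - _) *m _](_ : _ = 1%:M - orthproj S); last first.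
    by rewrite mulmxBr mulmx1 mulmxBl mul1mx proj_idem subrr subr0.
  rewrite adjmxM mulmxBr mulmx1 !mulmxBl -(mulmxA V^H) onbasis_orthonormal mulmx1 Vu.
  rewrite /orthproj !mulmxA -(mulmxA V^H) QE -(mulmxA _ E^H) EQ !adjmxM adjmxK rdiag_adj.
  rewrite !mulmxA Vu mul1mx -(mulmxA _ U^H) Uu mulmx1 -(mulmxA _ V^H) Vu mulmx1.
  rewrite rdiagM => [|k leSk _ _]; last by rewrite nth_default ?mul0r // ss geq_min leSk.
  by rewrite -rdiag1 rdiagB.
have [a a0] := gram_diag_real ((1%:M - orthproj S) *m Q *m V) (Ordinal ltiT).
rewrite ZZ mxE eqxx => /of_real_inj /=; have := s0 i; nra.
Qed.

(** In the basis [E *m U] of [S] the Gram matrix of (1 - P_T) P_S is diag(1 - s_i^2). With dim S <=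
    dim T there is one angle for each basis vector of [S]; otherwise directions of [S] with sine 1
    would be missing from the list. *)
Lemma uinorm_sinTheta (N : 'M[K]_n -> R) S T : unitarily_invariant_norm N ->
  (\dim S <= \dim T)%N -> N (sinTheta S T) = N ((1%:M - orthproj T) *m orthproj S).
Proof.
move=> Nui leST; rewrite /sinTheta /principal_angles.
have [U V Uu Vu ss s01 EQ] := principal_decompositionP S T.
set s := singular_values _ in ss s01 EQ *; rewrite (minn_idPl leST) in ss.
set E := onbasis S in EQ *; set Q := onbasis T in EQ *.
have acosE i : (i < size s)%N ->
    [seq sin t | t <- [seq acos x | x <- s]]`_i = Num.sqrt (1 - s`_i ^+ 2).
  move=> ltis; rewrite (nth_map 0) ?size_map // (nth_map 0) // sin_acos //.
  by have := s01 i; lra.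
rewrite diag_seqE; apply/esym/(uinorm_gram Nui (E := E *m U)).
- by rewrite adjmxM mulmxA -(mulmxA U^H) onbasis_orthonormal mulmx1.
- by move=> i leSi; rewrite nth_default // !size_map ss.
have QE : Q^H *m E = (E^H *m Q)^H by rewrite adjmxM adjmxK.
rewrite compl_proj_gram proj_adj /orthproj -/E -/Q !mulmxA.
rewrite -(mulmxA (_ *m _) _ E^H) -(mulmxA E E^H).
rewrite !adjmxM !mulmxA; congr (_ *m _); rewrite -!mulmxA; congr (E *m _).
rewrite mulmxBl mul1mx mulmxBr onbasis_orthonormal.
rewrite -(mulmxA Q) QE [E^H *m (Q *m _)]mulmxA EQ !adjmxM adjmxK rdiag_adj.
rewrite !mulmxA -(mulmxA _ V^H) Vu mulmx1 -(mulmxA U).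
rewrite rdiagM => [|k leTk /leq_trans/(_ leST)]; last by rewrite ltnNge leTk.
rewrite -{1}(unitary_mulV Uu) -mulmxBl -{1}[U]mulmx1 -mulmxBr -rdiag1 rdiagB.
congr (_ *m _ *m _); apply: eq_rdiag => i ltiS _.
rewrite acosE ?ss // sqr_sqrtr -?expr2 //; have := s01 i; nra.
Qed.

(* [G] is the linear map whose graph over the projection of [H] to [S] is [H],
   extended by zero; since [tan (acos 0) = 1 / 0 = 0], no position hypothesis is needed. *)
Lemma uinorm_tanTheta S H : exists G : 'M[K]_n,
  [/\ forall v : 'cV_n, G *m v \in H,
      forall v, v \in mximage (orthproj S) H -> orthproj S *m (G *m v) = v &
      forall N, unitarily_invariant_norm N -> N ((1%:M - orthproj S) *m G) = N (tanTheta S H)].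
Proof.
rewrite /tanTheta /principal_angles.
have [U V Uu Vu ss s01 EQ] := principal_decompositionP S H.
set s := singular_values _ in ss s01 EQ *.
set E := onbasis S in EQ *; set Q := onbasis H in EQ *.
have QE : Q^H *m E = (E^H *m Q)^H by rewrite adjmxM adjmxK.
have s_def i : (minn (\dim S) (\dim H) <= i)%N -> s`_i = 0.
  by move=> le; rewrite nth_default ?ss.
have s_defS i : (\dim S <= i)%N -> s`_i = 0 by move=> le; rewrite s_def // geq_min le.
have s_defH i : (\dim H <= i)%N -> s`_i = 0 by move=> le; rewrite s_def // geq_min le orbT.
(* In the principal bases [Q *m V] and [E *m U] the projection from [H] to [S] is diag(s), so its
   inverse on the image is diag(1/s), with 0 at the right angles. *)
pose D := rdiag c (\dim H) (\dim S) (fun i => (s`_i)^-1).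
exists (Q *m V *m D *m U^H *m E^H); split.
- by move=> v; rewrite mem_proj !mulmxA /orthproj -/Q -(mulmxA Q) onbasis_orthonormal mulmx1.
- move=> _ /mem_mximage[w wH ->]; rewrite -(proj_fix wH) /orthproj -/E -/Q !mulmxA.
  congr (_ *m w); rewrite -!mulmxA; congr (E *m _); rewrite !mulmxA; congr (_ *m Q^H).
  rewrite -(mulmxA _ E^H E) onbasis_orthonormal mulmx1 -(mulmxA _ E^H Q) EQ !mulmxA.
  rewrite -(mulmxA _ V^H V) Vu mulmx1 -(mulmxA _ U^H U) Uu mulmx1.
  rewrite -(mulmxA U) rdiagM => [|k le _ _]; last by rewrite s_defH ?mul0r.
  rewrite -(mulmxA U) rdiagM => [|k le _ _]; last by rewrite s_defS ?mul0r.
  congr (_ *m _ *m _); apply: eq_rdiag => i _ _.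
  by have [->|si] := eqVneq s`_i 0; rewrite ?mul0r // divff // mul1r.
move=> N Nui; rewrite diag_seqE; apply: (uinorm_gram Nui (E := E *m U)).
- by rewrite adjmxM mulmxA -(mulmxA U^H) onbasis_orthonormal mulmx1.
- by move=> i leSi; rewrite nth_default // !size_map ss geq_min leSi.
rewrite compl_proj_gram !adjmxM !adjmxK rdiag_adj /orthproj -/E !mulmxA.
congr (_ *m _ *m _).
rewrite -!mulmxA; congr (E *m (U *m _)).
rewrite (mulmxA Q^H) mulmxBr mulmx1 (mulmxA Q^H) QE !mulmxA.
rewrite -(mulmxA _ _ Q) mulmxBl onbasis_orthonormal -(mulmxA _ E^H) EQ.
rewrite !adjmxM adjmxK rdiag_adj.
rewrite !mulmxA -(mulmxA _ U^H U) Uu mulmx1.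
rewrite -(mulmxA V) rdiagM => [|k le _ _]; last by rewrite s_defS ?mul0r.
set X := rdiag c (\dim H) (\dim H) _.
have -> : 1%:M - V *m X *m V^H = V *m (1%:M - X) *m V^H.
  by rewrite mulmxBr mulmxBl mulmx1 unitary_mulV.
rewrite /X -rdiag1 rdiagB.
rewrite !mulmxA -(mulmxA _ V^H V) Vu mulmx1 -(mulmxA _ V^H V) Vu mulmx1.
rewrite rdiagM => [|k le _ _]; last by rewrite s_defH ?invr0 ?mul0r.
rewrite rdiagM => [|k le _ _]; last by rewrite s_defH ?invr0 ?mulr0.
(* Past the list both sides are 0; inside it, (1 - s^2)/s^2 is the squared tangent of acos s. *)
apply: eq_rdiag => i _ _; have [le|lt] := leqP (size s) i.
  by rewrite s_def -?ss // [X in _ = X ^+ 2]nth_default ?size_map // invr0 !mul0r expr0n.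
have /andP[s0 s1] := s01 i.
rewrite (nth_map 0) ?size_map // (nth_map 0) // /tan sin_acos ?acosK ?in_itv /=; try lra.
by rewrite expr_div_n sqr_sqrtr; [rewrite -exprVn; ring | nra].
Qed.

End PrincipalAngles.

(** * Functions of a diagonalised matrix and the graph estimate *)

Section DiagonalOperators.
Variables (R : realType) (c : scalar_kind).
Local Notation K := (scalars R c).

Lemma mxeval_diag m (phi : {poly K}) (d : 'rV[K]_m) :
  mxeval phi (diag_mx d) = diag_mx (\row_i phi.[d 0 i]).
Proof.
have diagX k : diag_mx d ^+ k = diag_mx (\row_i d 0 i ^+ k).
  elim: k => [|k IH].
    by rewrite expr0; apply/matrixP => i j; rewrite !mxE expr0.
  rewrite exprS IH; apply/matrixP => i j; rewrite -[_ * _]/(_ *m _) mul_diag_mx !mxE exprS.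
  by rewrite mulrnAr.
apply/matrixP => i j; rewrite summxE !mxE horner_coef -sumrMnl.
by apply: eq_bigr => k _; rewrite diagX !mxE mulrnAr.
Qed.

Lemma mxeval_conj n (phi : {poly K}) (X D : 'M[K]_n) : unitary X ->
  mxeval phi (X *m D *m X^H) = X *m mxeval phi D *m X^H.
Proof.
move=> Xu; have conjX k : (X *m D *m X^H) ^+ k = X *m D ^+ k *m X^H.
  elim: k => [|k IH]; first by rewrite !expr0 mulmx1 unitary_mulV.
  rewrite !exprS IH -[_ * _ in LHS]/(_ *m _) -[D * _]/(D *m _).
  by rewrite !mulmxA -(mulmxA _ X^H X) Xu mulmx1.
rewrite /mxeval mulmx_sumr mulmx_suml; apply: eq_bigr => i _.
by rewrite conjX -scalemxAr -scalemxAl.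
Qed.

Lemma diag_unit_neq0 m (d : 'rV[K]_m) : diag_mx d \in unitmx -> forall i, d 0 i != 0.
Proof.
rewrite unitmxE det_diag unitfE => /prodf_neq0 d0 i; exact: d0.
Qed.

Lemma invmx_diag m (d : 'rV[K]_m) : (forall i, d 0 i != 0) ->
  invmx (diag_mx d) = diag_mx (\row_i (d 0 i)^-1).
Proof.
move=> d0; have dd : diag_mx d *m diag_mx (\row_i (d 0 i)^-1) = 1%:M.
  by apply/matrixP => i j; rewrite mul_diag_mx !mxE mulrnAr divff.
by have [du _] := mulmx1_unit dd; rewrite -[LHS]mulmx1 -dd mulKmx.
Qed.

Lemma vnorm_diag_bound m (d : 'rV[K]_m) (v : 'cV[K]_m) : vnorm v <= 1 ->
  vnorm (diag_mx d *m v) <= Num.sqrt (\sum_i modulus (d 0 i) ^+ 2).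
Proof.
move=> v1; apply: ler_wsqrtr; apply: ler_sum => i _.
rewrite mul_diag_mx mxE modulusM exprMn ler_piMr ?sqr_ge0 //.
have : \sum_i modulus (v i 0) ^+ 2 <= 1.
  by rewrite -sqrtr1 in v1; rewrite -ler_sqrt.
apply: le_trans; rewrite (bigD1 i) //= lerDl sumr_ge0 // => k _; exact: sqr_ge0.
Qed.

(** The supremum in [opnorm] is meaningful only for a bounded set; the Frobenius norm is a
    sufficient bound. *)
Lemma opnorm_diag_has_ubound m (d : 'rV[K]_m) :
  has_ubound [set vnorm (diag_mx d *m v) | v in [set v : 'cV[K]_m | vnorm v <= 1]]%classic.
Proof.
exists (Num.sqrt (\sum_i modulus (d 0 i) ^+ 2)) => _ [v v1 <-].
exact: vnorm_diag_bound.
Qed.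

(** Testing the zero vector also covers size 0, where no diagonal entry is available. *)
Lemma opnorm_diag_ge0 m (d : 'rV[K]_m) : 0 <= opnorm (diag_mx d).
Proof.
have vn0 : vnorm (0 : 'cV[K]_m) = 0.
  by rewrite /vnorm big1 ?sqrtr0 // => i _; rewrite mxE modulus0 expr0n.
apply: (ub_le_sup (opnorm_diag_has_ubound d)); exists 0; last by rewrite mulmx0.
by rewrite /= vn0 ler01.
Qed.

Lemma opnorm_diag_ge m (d : 'rV[K]_m) i : modulus (d 0 i) <= opnorm (diag_mx d).
Proof.
have vnE (a : K) : vnorm (a *: delta_mx i 0 : 'cV[K]_m) = modulus a.
  rewrite /vnorm (bigD1 i) //= big1 => [|k ki].
    by rewrite !mxE !eqxx mulr1 addr0 sqrtr_sqr ger0_norm // modulus_ge0.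
  by rewrite !mxE (negPf ki) mulr0 modulus0 expr0n.
apply: (ub_le_sup (opnorm_diag_has_ubound d)); exists (delta_mx i 0).
  by rewrite /= -[delta_mx _ _]scale1r vnE -(rmorph1 (of_real c)) modulus_of_real normr1.
rewrite -(vnE (d 0 i)); congr vnorm; apply/matrixP => k l.
by rewrite mul_diag_mx !mxE; case: eqVneq => [->//|_]; rewrite !mulr0.
Qed.

Variables (n : nat) (X : 'M[K]_n) (X_unitary : unitary X).

(** phi(A), the projections to the X_l, and the inverses and truncations of phi(A) all have this
    form, so identities between them are checked eigenvalue by eigenvalue. *)
Definition diagop (f : 'I_n -> K) : 'M[K]_n := X *m diag_mx (\row_i f i) *m X^H.

Lemma eq_diagop f g : f =1 g -> diagop f = diagop g.
Proof. by move=> fg; congr (_ *m diag_mx _ *m _); apply/rowP => i; rewrite !mxE. Qed.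

Lemma diagopM f g : diagop f *m diagop g = diagop (fun i => f i * g i).
Proof.
rewrite /diagop !mulmxA -(mulmxA _ X^H X) X_unitary mulmx1 -(mulmxA X).
congr (_ *m _ *m _); apply/matrixP => i j.
by rewrite mul_diag_mx !mxE mulrnAr.
Qed.

Lemma diagopB f g : diagop f - diagop g = diagop (fun i => f i - g i).
Proof.
rewrite /diagop -mulmxBl -mulmxBr; congr (_ *m _ *m _).
by apply/matrixP => i j; rewrite !mxE mulrnBl.
Qed.

Lemma diagop1 : diagop (fun=> 1) = 1%:M.
Proof.
rewrite /diagop (_ : diag_mx _ = 1%:M) ?mulmx1 ?unitary_mulV //.
by apply/matrixP => i j; rewrite !mxE.
Qed.

Lemma diagop0 : diagop (fun=> 0) = 0.
Proof.
by rewrite -[RHS](subrr (diagop (fun=> 0))) diagopB; apply: eq_diagop => i; rewrite subrr.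
Qed.

Lemma proj_colspan_diagop b : orthproj (colspan X b) = diagop (fun i => (b i)%:R).
Proof.
rewrite proj_colspan //; congr (_ *m _ *m _); apply/matrixP => i j; rewrite !mxE.
by case: (eqVneq i j) => [->|ij]; rewrite ?eqxx ?rmorph_nat // ifN.
Qed.

Variables (N : 'M[K]_n -> R) (Nui : unitarily_invariant_norm N).

Lemma uinorm_diagopl f s M : 0 <= s -> (forall i, modulus (f i) <= s) ->
  N (diagop f *m M) <= s * N M.
Proof.
move=> s0 fs; rewrite -[in leRHS](uinorm_unitaryl Nui _ (unitary_adj X_unitary)).
rewrite /diagop -!mulmxA (uinorm_unitaryl Nui) //.
by apply: (uinorm_diagl Nui) => // i; rewrite mxE.
Qed.

Lemma uinorm_diagopr f s M : 0 <= s -> (forall i, modulus (f i) <= s) ->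
  N (M *m diagop f) <= s * N M.
Proof.
move=> s0 fs; rewrite -[in leRHS](uinorm_unitaryr Nui _ X_unitary).
rewrite /diagop !mulmxA (uinorm_unitaryr Nui); last exact: unitary_adj.
by apply: (uinorm_diagr Nui) => // i; rewrite mxE.
Qed.

(* If [u] lies in the projection of [H] to [X_l], then [F G u] differs from
   [F u] by the image of [u] under [(1 - P) F G], and [F G u] lies in [F(H)]. *)
Lemma uinorm_gap_bound (f : 'I_n -> K) (H T : {vspace 'cV[K]_n}) (Q : 'M[K]_n) l m a b :
  (l <= m)%N -> (forall i : 'I_n, (i < l)%N -> f i != 0) ->
  0 <= a -> (forall i : 'I_n, (i < l)%N -> modulus (f i)^-1 <= a) ->
  0 <= b -> (forall i : 'I_n, (m <= i)%N -> modulus (f i) <= b) ->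
  (H <= orthc (colspan X (fun i => l <= i < m)%N))%VS ->
  (forall v, v \in H -> diagop f *m v \in T) ->
  Q^H = Q -> Q *m Q = Q ->
  (forall v : 'cV_n, Q *m v \in mximage (diagop f *m orthproj (leading X l)) H) ->
  N ((1%:M - orthproj T) *m Q) <= a * b * N (tanTheta (leading X l) H).
Proof.
move=> lelm f0 a0 fa b0 fb Hl HT Qh QQ QH.
have [G [GH GP /(_ N Nui) <-]] := uinorm_tanTheta (leading X l) H.
set F := diagop f in HT QH *; set P := orthproj (leading X l) in QH GP *.
have PE : P = diagop (fun i => (i < l)%N%:R) by exact: proj_colspan_diagop.
(* [D] inverts [F] on X_l and vanishes on its complement; [FC] keeps only the part of [F] with
   indices from [m] on, whose eigenvalues are bounded by [b]. *)
pose D := diagop (fun i => if (i < l)%N then (f i)^-1 else 0).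
pose FC := diagop (fun i => if (m <= i)%N then f i else 0).
have FDF : D *m F *m P = P.
  rewrite PE !diagopM; apply: eq_diagop => i.
  by case: ltnP => li; rewrite ?mulr0 // mulr1 mulVf ?f0.
have comm : P *m F = F *m P.
  by rewrite PE !diagopM; apply: eq_diagop => i; rewrite mulrC.
have PG : diagop (fun i => (l <= i < m)%N%:R) *m G = 0.
  apply: eq_mulmx_cV => v; rewrite mul0mx -mulmxA.
  rewrite -(proj_colspan_diagop (fun i => (l <= i < m)%N)).
  by apply/eqP; rewrite -mem_orthc (subvP Hl).
(* The range of [G] lies in [H], hence avoids the columns from [l] to [m - 1]; after removing X_l
   only indices from [m] on remain, where [F] and [FC] agree. *)
have FPG : F *m ((1%:M - P) *m G) = FC *m ((1%:M - P) *m G).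
  apply/eqP; rewrite -subr_eq0 -mulmxBl PE -diagop1 !diagopB mulmxA diagopM.
  apply/eqP; rewrite -[RHS](mulmx0 _ F) -PG mulmxA /F diagopM; congr (_ *m _).
  apply: eq_diagop => i; rewrite [(l <= _)%N]leqNgt.
  by case: ltnP => li; case: ltnP => im //=; rewrite ?(subrr, subr0, mulr0, mulr1, mul0r) //.
have ND M : N (M *m D) <= a * N M.
  by apply: uinorm_diagopr => // i; case: ifP => li; [exact: fa | rewrite modulus0].
have NFC M : N (FC *m M) <= b * N M.
  by apply: uinorm_diagopl => // i; case: ifP => im; [exact: fb | rewrite modulus0].
clearbody F P D FC.
(* A vector Qv has the form F P w with [w] in [H], so D Q v = P w lies in P(H), where P G is the
   identity. *)
have PFGDQ : P *m (F *m G *m D *m Q) = Q.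
  apply: eq_mulmx_cV => v; have /mem_mximage[w wH Qv] := QH v.
  have DQ : D *m (Q *m v) = P *m w by rewrite Qv -[in RHS]FDF !mulmxA.
  rewrite -!mulmxA DQ (mulmxA P) comm -mulmxA GP; last exact: mximage_mem.
  by rewrite Qv mulmxA.
set PT := orthproj T.
have TFG : (1%:M - orthproj T) *m (F *m G *m D *m Q) = 0.
  apply: eq_mulmx_cV => v; rewrite mul0mx -!mulmxA mulmxBl mul1mx.
  by rewrite /PT proj_fix ?subrr // HT // GH.
have FPGDQ : F *m ((1%:M - P) *m G) *m D *m Q = F *m G *m D *m Q - Q.
  rewrite -[X in _ = _ - X]PFGDQ !mulmxA comm.
  by rewrite mulmxBr mulmx1 !mulmxBl.
have -> : (1%:M - orthproj T) *m Q =
    - ((1%:M - orthproj T) *m (FC *m ((1%:M - P) *m G) *m D *m Q)).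
  by rewrite -FPG FPGDQ mulmxBr TFG sub0r opprK.
rewrite (uinormN Nui); apply: le_trans (uinorm_projl Nui _ _ _) _.
- by rewrite adjmxB adjmx1 proj_adj.
- by rewrite mulmxBr mulmx1 mulmxBl mul1mx proj_idem subrr subr0.
apply: le_trans (uinorm_projr Nui _ Qh QQ) _; rewrite -mulrA.
apply: le_trans (ND _) _; rewrite ler_wpM2l //.
Qed.

End DiagonalOperators.

(** * Index counts, transversality and admissible subspaces *)

Lemma sum_interval n a p : (a + p <= n)%N -> (\sum_(i < n) (a <= i < a + p))%N = p.
Proof.
move=> leapn; rewrite -(big_mkord xpredT (fun i => (a <= i < a + p) : nat)).
rewrite (@big_cat_nat _ _ _ a) /=; [|lia|lia].
rewrite (@big_cat_nat _ _ _ (a + p) a) /=; [|lia|lia].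
rewrite big_nat big1 => [|i ?]; last by lia.
rewrite [X in (_ + (_ + X))%N]big_nat [X in (_ + (_ + X))%N]big1 => [|i ?]; last by lia.
rewrite big_nat (eq_bigr (fun=> 1%N)) => [|i ?]; last by lia.
by rewrite -big_nat sum_nat_const_nat; lia.
Qed.

Section AdmissibleSubspaces.
Variables (R : realType) (c : scalar_kind) (n : nat).
Local Notation K := (scalars R c).
Variables (X : 'M[K]_n) (X_unitary : unitary X).
Implicit Types (S T W H C : {vspace 'cV[K]_n}).

Lemma dim_leading l : (l <= n)%N -> \dim (leading X l) = l.
Proof. by move=> len; rewrite dim_colspan // -[RHS](@sum_interval n 0 l). Qed.

Lemma colspan_mono (b b' : pred nat) : (forall i, b i -> b' i) ->
  (colspan X b <= colspan X b')%VS.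
Proof.
move=> bb'; apply: colspan_sub => i /bb' b'i; rewrite colE; apply: mem_colspan_mul => k.
by rewrite mxE; case: eqVneq => // ->; rewrite b'i.
Qed.

Lemma colspan_disjointM (b b' : pred nat) : (forall i, b i -> b' i -> false) ->
  orthproj (colspan X b) *m orthproj (colspan X b') = 0.
Proof.
move=> bb'; rewrite !proj_colspan_diagop // diagopM // -[RHS](diagop0 X).
apply: eq_diagop => i; rewrite -natrM mulnb.
by case: (boolP (_ && _)) => // /andP[bi]; move/(bb' _ bi).
Qed.

Lemma orthproj_add S S' : orthproj S *m orthproj S' = 0 ->
  orthproj (S + S') = orthproj S + orthproj S'.
Proof.
move=> SS'; have S'S : orthproj S' *m orthproj S = 0.
  by rewrite -[LHS]adjmxK adjmxM !proj_adj SS' adjmx0.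
apply: proj_uniq => [|v|_ /memv_addP[v vS [w wS' ->]]].
- by rewrite adjmxD !proj_adj.
- by rewrite mulmxDl memv_add ?proj_mem.
rewrite mulmxDl !mulmxDr (proj_fix vS) (proj_fix wS') -{1}(proj_fix wS') -{2}(proj_fix vS).
by rewrite (mulmxA (orthproj S)) SS' (mulmxA (orthproj S')) S'S !mul0mx add0r addr0.
Qed.

Lemma dim_orthproj_add S S' : orthproj S *m orthproj S' = 0 ->
  \dim (S + S') = (\dim S + \dim S')%N.
Proof.
by move=> /orthproj_add /dim_proj; apply; rewrite mxtraceD !mxtrace_proj natrD.
Qed.

(** By the hypothesis, [W] projects onto the span of the columns in [b'], so orthogonality to them
    costs exactly one dimension per column. *)
Lemma orthc_cap_dim W (b b' : pred nat) : (forall i, b' i -> b i) ->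
  (orthc W :&: colspan X b = 0)%VS ->
  (\dim (W :&: orthc (colspan X b')) + \sum_(i < n) b' i)%N = \dim W.
Proof.
move=> b'b Wb0; rewrite -(dim_orthc_cap W (colspan X b')) -(dim_colspan b' X_unitary).
congr (_ + \dim _)%N; apply/esym/mximage_proj_full/eqP.
by rewrite -subv0 -Wb0 capvS // colspan_mono.
Qed.

(** A vector [v] in the span of [b0] is P_b w for some [w] in [W]. As [b0] and [b'] are disjoint,
    [w] is orthogonal to the [b'] columns, so [v] is orthogonal to [w] and v^H v = w^H P_b v = w^H v
    = 0. *)
Lemma orthc_cap_transversal W (b b' b0 : pred nat) :
  (forall i, b' i -> b i) -> (forall i, b0 i -> b i) ->
  (forall i, b' i -> b0 i -> false) ->
  (orthc W :&: colspan X b = 0)%VS ->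
  (orthc (W :&: orthc (colspan X b')) :&: colspan X b0 = 0)%VS.
Proof.
move=> b'b b0b b'b0 Wb0; apply/eqP; rewrite -subv0; apply/subvP => v.
rewrite memv_cap memv0 => /andP[vH vb0].
have vb : v \in colspan X b by apply: (subvP (colspan_mono b0b)).
have [w wW vw] : exists2 w, w \in W & v = orthproj (colspan X b) *m w.
  by apply/mem_mximage; rewrite mximage_proj_full.
have wH : w \in (W :&: orthc (colspan X b'))%VS.
  rewrite memv_cap wW mem_orthc -(projM_subr (colspan_mono b'b)) -mulmxA -vw.
  by rewrite -(proj_fix vb0) mulmxA colspan_disjointM // mul0mx /= eqxx.
apply/eqP/gram_eq0; rewrite {1}vw adjmxM proj_adj -mulmxA (proj_fix vb).
by have /orthcP/(_ w wH) := vH.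
Qed.

(** Projecting [B] to X_j leaves an image of dimension at most [j], so the part of [B] orthogonal to
    X_j has dimension at least [h - j]. *)
Lemma exists_admissible (B : {vspace 'cV[K]_n}) j h k : (j <= h)%N -> (h <= k)%N ->
  (k <= n)%N -> (B <= leading X k)%VS -> (h <= \dim B)%N ->
  exists2 S' : {vspace 'cV[K]_n}, (S' <= B)%VS &
    Lambda_adm X j k h (leading X j + S')%VS /\
    orthproj (leading X j + S') = orthproj (leading X j) + orthproj S'.
Proof.
move=> lejh lehk lekn Bk lehB; have lejn : (j <= n)%N by lia.
have dimPB : (\dim (mximage (orthproj (leading X j)) B) <= j)%N.
  rewrite -[leqRHS](dim_leading lejn); apply: dimvS.
  by apply/subvP => _ /mem_mximage[w _ ->]; exact: proj_mem.
have [|S' S'B dimS'] := @exists_subspace R c n (B :&: orthc (leading X j)) (h - j).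
  by have := dim_orthc_cap B (leading X j); lia.
have PS' : orthproj (leading X j) *m orthproj S' = 0.
  apply: eq_mulmx_cV => v; rewrite mul0mx -mulmxA; apply/eqP; rewrite -mem_orthc.
  by have := subvP S'B _ (proj_mem S' v); rewrite memv_cap => /andP[].
have S'B' : (S' <= B)%VS := subv_trans S'B (capvSl _ _).
exists S' => //; split; last exact: orthproj_add.
split.
- by rewrite dim_orthproj_add // dim_leading // dimS'; lia.
- exact: addvSl.
- rewrite subv_add (subv_trans S'B' Bk) andbT; apply: colspan_mono => i /leq_trans; apply; lia.
Qed.

End AdmissibleSubspaces.

(** * Rank and vanishing eigenvalues *)

Lemma dim_rank_proj (R : realType) (c : scalar_kind) n (W : {vspace 'cV[scalars R c]_n}) :
  (\dim W <= \rank (orthproj W))%N.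
Proof.
have e : (onbasis W)^H *m orthproj W *m onbasis W = 1%:M.
  by rewrite /orthproj !mulmxA onbasis_orthonormal mul1mx onbasis_orthonormal.
rewrite -[X in (X <= _)%N](mxrank1 (scalars R c)) -e.
exact: leq_trans (mxrankM_maxl _ _) (mxrankM_maxr _ _).
Qed.

(** One more nonzero eigenvalue would give [k + 1] of them; the projection to their eigenvectors
    factors through the matrix, which would then have rank above [k]. *)
Lemma rank_eigen_eq0 (R : realType) (c : scalar_kind) n (X : 'M[scalars R c]_n)
    (f : 'I_n -> scalars R c) k : unitary X -> k = \rank (diagop X f) ->
  (forall i : 'I_n, (i < k)%N -> f i != 0) -> forall i : 'I_n, (k <= i)%N -> f i = 0.
Proof.
move=> Xu rk f0 i0 lek; apply/eqP/negPn/negP => fi0.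
pose b i := (i < k)%N || (i == i0 :> nat).
have fb (i : 'I_n) : b i -> f i != 0 by case/orP => [/f0 //|/eqP/val_inj ->].
have dimb : \dim (colspan X b) = k.+1.
  rewrite dim_colspan // (eq_bigr (fun i : 'I_n => (i < k) + (i0 <= i < i0 + 1))%N).
    have ltin := ltn_ord i0; have sum_k : (\sum_(i < n) (i < k))%N = k.
      by apply: (@sum_interval n 0 k); lia.
    by rewrite big_split /= sum_k sum_interval; lia.
  by move=> i _; rewrite /b; lia.
have := dim_rank_proj (colspan X b); rewrite dimb leqNgt ltnS rk.
pose g (i : 'I_n) := if b i then (f i)^-1 else 0.
rewrite (_ : orthproj _ = diagop X f *m diagop X g) ?mxrankM_maxl //.
rewrite proj_colspan_diagop // diagopM //; apply: eq_diagop => i; rewrite /g.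
by case bi: (b i); rewrite ?mulr0 // divff ?fb.
Qed.

(** * The operator norms of the bound as bounds on the eigenvalues of phi(A) *)

Section MainBound.
Variables (R : realType) (c : scalar_kind) (n : nat).
Local Notation K := (scalars R c).
Variables (lam : n.-tuple R) (phi : {poly K}).

Definition eigval (i : 'I_n) : K := phi.[of_real c lam`_i].

(** Invertibility is given at size [k]; it means that phi is nonzero at each of the first [k]
    eigenvalues, which passes to every shorter leading block. *)
Lemma opnorm_inv_leading k l (i : 'I_n) : (l <= k)%N ->
  mxeval phi (diag_seq c k lam) \in unitmx -> (i < l)%N ->
  eigval i != 0 /\ modulus (eigval i)^-1 <= opnorm (invmx (mxeval phi (diag_seq c l lam))).
Proof.
move=> lelk; rewrite /diag_seq !mxeval_diag => /diag_unit_neq0 d0 ltil.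
have d0' j : (j < k)%N -> phi.[of_real c lam`_j] != 0.
  by move=> ltjk; have := d0 (Ordinal ltjk); rewrite !mxE.
split; first by apply: d0'; exact: leq_trans lelk.
rewrite invmx_diag => [|j]; last by rewrite !mxE d0' // (leq_trans (ltn_ord j)).
by set d := (\row_j _^-1); have := opnorm_diag_ge d (Ordinal ltil); rewrite !mxE.
Qed.

Lemma opnorm_inv_ge0 k l : (l <= k)%N -> mxeval phi (diag_seq c k lam) \in unitmx ->
  0 <= opnorm (invmx (mxeval phi (diag_seq c l lam))).
Proof.
move=> lelk; rewrite /diag_seq !mxeval_diag => /diag_unit_neq0 d0.
rewrite invmx_diag ?opnorm_diag_ge0 // => j.
by have := d0 (widen_ord lelk j); rewrite !mxE.
Qed.

Lemma opnorm_drop_ge0 m : 0 <= opnorm (mxeval phi (diag_seq c (n - m) (drop m lam))).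
Proof. by rewrite /diag_seq mxeval_diag opnorm_diag_ge0. Qed.

Lemma opnorm_drop m (i : 'I_n) : (m <= i)%N ->
  modulus (eigval i) <= opnorm (mxeval phi (diag_seq c (n - m) (drop m lam))).
Proof.
move=> lemi; have ltim : (i - m < n - m)%N by rewrite ltn_sub2r // (leq_ltn_trans lemi).
rewrite /diag_seq mxeval_diag.
set d := (\row_j phi.[_]); have := opnorm_diag_ge d (Ordinal ltim).
by rewrite !mxE /= nth_drop subnKC.
Qed.

Lemma mxeval_diagop (X : 'M[K]_n) : unitary X ->
  mxeval phi (X *m diag_seq c n lam *m X^H) = diagop X eigval.
Proof.
move=> Xu; rewrite mxeval_conj // /diag_seq mxeval_diag /diagop; congr (_ *m diag_mx _ *m _).
by apply/rowP => i; rewrite !mxE.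
Qed.

End MainBound.

(* The eigenvalues and the columns of X are indexed from 0: lambda_i is
   lam`_(i.-1) and x_i is column i.-1 of X. *)
Theorem theorem4p4 (R : realType) (c : scalar_kind) (n : nat)
    (A X : 'M[scalars R c]_n) (lam : n.-tuple R)
    (j h k r p1 p2 : nat) (W : {vspace 'cV[scalars R c]_n})
    (A_selfadjoint : adjmx A = A)
    (lam_sorted : sorted >=%R lam)
    (X_unitary : unitary X)
    (A_eigendec : A = X *m diag_seq c n lam *m adjmx X)
    (lt_jh : (j < h)%N) (lt_hk : (h < k)%N)
    (le_k_rank : (k <= \rank A)%N) (lt_kn : (k < n)%N)
    (* lambda_j > lambda_(j+1), void for j = 0 as lambda_0 = oo *)
    (gap_j : (0 < j)%N -> lam`_j < lam`_j.-1)
    (gap_k : lam`_k < lam`_k.-1)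
    (dimW : \dim W = r) (le_hr : (h <= r)%N) (lt_rk : (r < k)%N)
    (le_p : (p1 + p2 <= r - h)%N) (le_kp2 : (k + p2 <= n)%N)
    (W_orth : (orthc W :&:
       colspan X (fun i => (i < j + p1) || (k <= i < k + p2))%N = 0)%VS)
    (W_lead : (W :&: orthc (leading X k) = 0)%VS) :
  exists Hp : {vspace 'cV[scalars R c]_n},
    [/\ (Hp <= W)%VS,
        \dim Hp = (r - (p1 + p2))%N,
        (h <= r - (p1 + p2))%N,
        (orthc Hp :&: leading X j = 0)%VS &
        (Hp :&: orthc (leading X k) = 0)%VS] /\
    forall (phi : {poly scalars R c}) (N : 'M[scalars R c]_n -> R),
      mxeval phi (diag_seq c k lam) \in unitmx ->
      unitarily_invariant_norm N ->
      dist_adm N X j k h (mximage (mxeval phi A) W) <=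
        (if j == 0%N then 0 else
           opnorm (invmx (mxeval phi (diag_seq c j lam))) *
           opnorm (mxeval phi (diag_seq c (n - (j + p1)) (drop (j + p1) lam))) *
           N (tanTheta (leading X j) Hp)) +
        (if (k == \rank A) && (phi.[0] == 0) then 0 else
           opnorm (invmx (mxeval phi (diag_seq c k lam))) *
           opnorm (mxeval phi (diag_seq c (n - (k + p2)) (drop (k + p2) lam))) *
           N (tanTheta (leading X k) Hp)).
Proof.
pose b' i := ((j <= i < j + p1) || (k <= i < k + p2))%N.
set C := colspan X b'; pose Hp := (W :&: orthc C)%VS.
have HpW : (Hp <= W)%VS := capvSl _ _.
have dimHp : \dim Hp = (r - (p1 + p2))%N.
  have := orthc_cap_dim X_unitary (b' := b') _ W_orth.
  rewrite dimW => <- => [|i]; last by rewrite /b'; lia.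
  (* The two intervals are disjoint, as j + p1 <= j + (r - h) < k, so their indicators add up. *)
  rewrite (eq_bigr (fun i : 'I_n => (j <= i < j + p1) + (k <= i < k + p2))%N); last first.
    by move=> i _; rewrite /b'; lia.
  by rewrite big_split /= !sum_interval ?addnK //; lia.
(* The index set of [W_orth] also contains the indices below [j], which are disjoint from [b']. *)
have Hp_j : (orthc Hp :&: leading X j = 0)%VS.
  by apply: (orthc_cap_transversal X_unitary _ _ _ W_orth) => i; rewrite /b'; lia.
have Hp_k : (Hp :&: orthc (leading X k) = 0)%VS.
  by apply/eqP; rewrite -subv0 -W_lead capvS.
have Hp_sub (b : pred nat) : (forall i, b i -> b' i) -> (Hp <= orthc (colspan X b))%VS.
  move=> bb'; apply: subv_trans (capvSr _ _) _.
  apply/subvP => v; rewrite !mem_orthc => /eqP Cv.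
  by rewrite -(projM_subr (colspan_mono X bb')) -mulmxA Cv mulmx0.
exists Hp; split; first by split=> //; lia.
move=> phi N phik Nui; pose f := @eigval R c n lam phi.
have FE : mxeval phi A = diagop X f by rewrite A_eigendec mxeval_diagop.
set F := mxeval phi A in FE *; set T := mximage F W.
have HpT v : v \in Hp -> diagop X f *m v \in T.
  by move=> vH; rewrite -FE mximage_mem // (subvP HpW).
have f0 l (i : 'I_n) : (l <= k)%N -> (i < l)%N -> f i != 0.
  by move=> lelk ltil; case: (opnorm_inv_leading lelk phik ltil).
(* [Dk] inverts [F] on [X_k], so [F v = 0] forces [v] orthogonal to [X_k]. *)
pose Dk := diagop X (fun i => if (i < k)%N then (f i)^-1 else 0).
have DkF : Dk *m F = orthproj (leading X k).
  rewrite FE proj_colspan_diagop // diagopM //; apply: eq_diagop => i.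
  by case: ifP => ik; rewrite ?mul0r // mulVf // (f0 k).
have PkF : orthproj (leading X k) *m F = F *m orthproj (leading X k).
  by rewrite FE proj_colspan_diagop // !diagopM //; apply: eq_diagop => i; rewrite mulrC.
have Pk_inj U v : (U :&: orthc (leading X k) = 0)%VS -> v \in U ->
    orthproj (leading X k) *m v = 0 -> v = 0.
  by move=> U0 vU Pv; apply/eqP; rewrite -memv0 -U0 memv_cap vU mem_orthc Pv /=.
(* This yields dim S = h <= r = dim T, as [uinorm_sinTheta] requires. *)
have dimT : \dim T = r.
  rewrite dim_mximage // => w wW Fw.
  by apply: (Pk_inj W) => //; rewrite -DkF -mulmxA Fw mulmx0.
(* Since [F] commutes with the projection to X_k, this is the projection of F(H_p) to X_k, in the
   form that [uinorm_gap_bound] asks of the range of its projection. *)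
pose B := mximage (F *m orthproj (leading X k)) Hp.
have dimB : \dim B = (r - (p1 + p2))%N.
  rewrite dim_mximage // => w wH FPw; apply: (Pk_inj Hp) => //.
  by rewrite -[X in X *m w]proj_idem -{1}DkF -(mulmxA Dk) -(mulmxA Dk) FPw mulmx0.
have Bk : (B <= leading X k)%VS.
  by apply/subvP => _ /mem_mximage[w _ ->]; rewrite -PkF -mulmxA proj_mem.
have [|||||S' S'B [Sadm PS]] := @exists_admissible _ _ _ _ X_unitary B j h k.
1-5: by rewrite ?dimB //; lia.
set S := (_ + S')%VS in Sadm PS.
have dimS : \dim S = h by case: Sadm.
apply: (@le_trans _ _ (N (sinTheta S T))).
  apply: ge_inf; last by exists S.
  by exists 0 => _ [U _ <-]; exact: uinorm_ge0.
rewrite uinorm_sinTheta ?dimS ?dimT // PS mulmxDr.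
apply: le_trans (uinorm_triangle Nui _ _) _; apply: lerD.
  case: eqP => [j0|_].
    rewrite (_ : orthproj (leading X j) = 0) ?mulmx0 ?uinorm0 // proj_colspan_diagop //.
    by rewrite -[RHS](diagop0 X); apply: eq_diagop => i; rewrite j0.
  have lejk : (j <= k)%N by lia.
  apply: (uinorm_gap_bound X_unitary Nui (f := f) (m := (j + p1)%N)) => //.
  - exact: leq_addr.
  - by move=> i; exact: f0.
  - exact: opnorm_inv_ge0 phik.
  - by move=> i ij; case: (opnorm_inv_leading lejk phik ij).
  - exact: opnorm_drop_ge0.
  - by move=> i; exact: opnorm_drop.
  - by apply: Hp_sub => i; rewrite /b' => ->.
  - exact: proj_adj.
  - exact: proj_idem.
  move=> v; have jk : (leading X j <= leading X k)%VS.
    by apply: colspan_mono => i ij; exact: leq_trans lejk.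
  have PjF : diagop X f *m orthproj (leading X j) = orthproj (leading X j) *m diagop X f.
    by rewrite proj_colspan_diagop // !diagopM //; apply: eq_diagop => i; rewrite mulrC.
  have DkPj : Dk *m orthproj (leading X j) = orthproj (leading X j) *m Dk.
    by rewrite proj_colspan_diagop // !diagopM //; apply: eq_diagop => i; rewrite mulrC.
  (* H_p projects onto X_j by [Hp_j], and [F] maps X_j onto itself: the preimage of P_j v is P_j Dk
     v. *)
  rewrite mximageM mximage_proj_full //; apply/mem_mximage.
  exists (orthproj (leading X j) *m (Dk *m v)); first exact: proj_mem.
  have FDk : diagop X f *m Dk = orthproj (leading X k).
    by rewrite -DkF FE !diagopM //; apply: eq_diagop => i; rewrite mulrC.
  rewrite (mulmxA (orthproj _)) -DkPj mulmxA (mulmxA (diagop X f)) FDk.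
  by rewrite projM_sub.
(* The tail bound [b] is left free: it is the operator norm in general, and 0 when the second term
   is omitted. *)
have bound b : 0 <= b -> (forall i : 'I_n, (k + p2 <= i)%N -> modulus (f i) <= b) ->
    N ((1%:M - orthproj T) *m orthproj S') <=
      opnorm (invmx (mxeval phi (diag_seq c k lam))) * b * N (tanTheta (leading X k) Hp).
  move=> b0 fb; apply: (uinorm_gap_bound X_unitary Nui (f := f) (m := (k + p2)%N)) => //.
  - exact: leq_addr.
  - by move=> i; exact: f0.
  - exact: opnorm_inv_ge0 phik.
  - by move=> i ik; case: (opnorm_inv_leading (leqnn k) phik ik).
  - by apply: Hp_sub => i; rewrite /b' => ->; rewrite orbT.
  - exact: proj_adj.
  - exact: proj_idem.
  - by move=> v; rewrite -FE; apply: (subvP S'B); exact: proj_mem.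
case: ifP => [/andP[/eqP k_rank /eqP phi0]|_]; last first.
  by apply: bound => [|i]; [exact: opnorm_drop_ge0 | exact: opnorm_drop].
rewrite -[leRHS](mul0r (N (tanTheta (leading X k) Hp))).
rewrite -[X in _ <= X * _](mulr0 (opnorm (invmx (mxeval phi (diag_seq c k lam))))).
apply: bound => // i lei; rewrite (_ : f i = 0) ?modulus0 //.
have AE : A = diagop X (fun i : 'I_n => of_real c lam`_i).
  by rewrite A_eigendec /diagop; congr (_ *m _ *m _).
have -> : f i = phi.[of_real c lam`_i] by [].
rewrite (@rank_eigen_eq0 R c n X (fun i : 'I_n => of_real c lam`_i) k) //.
- by rewrite -AE.
(* With phi(0) = 0, invertibility of phi(Lambda_k) makes the first [k] eigenvalues of [A] nonzero;
   as the rank is [k], the others vanish, and phi vanishes at them. *)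
- move=> l lk; apply: contraTneq (f0 k l (leqnn k) lk) => l0.
  by rewrite /f /eigval l0 phi0 eqxx.
exact: leq_trans (leq_addr _ _) lei.
Qed.
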